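(* The assignments $(-)_{\bowtie}\colon\mathsf{SRS}\to\mathsf{SS}$ and $(-)^{\bowtie}\colon\mathsf{SS}\to\mathsf{SRS}$ described below are functors and witness a (covariant) equivalence of categories between $\mathsf{SRS}$ and $\mathsf{SS}$.
   Context: Priestley space: compact $(X,\le,\tau)$ with a partial order such that $x\not\le y$ implies a clopen up-set contains $x$ not $y$; Esakia if $\downarrow U$ is clopen for clopen $U$. $\mathsf{SS}$: objects are unpointed Sugihara spaces $(X,\le,D,\tau)$, i.e. $(X,\le,\tau)$ Esakia, and with $Q=\le\cup\ge$, $D$ clopen, $(X,\le,Q,D,\tau)$ satisfies: $xQx$; ($xQy$, $x\in D$) $\Rightarrow x\le y$; ($xQy$, $y\le z$) $\Rightarrow zQx$. Morphisms: continuous p-morphisms $\varphi$ (isotone, and $\varphi(x)\le z\Rightarrow\exists y\ge x$, $\varphi(y)=z$) with $\varphi[D_X]\subseteq D_Y$, $\varphi[X\setminus D_X]\subseteq Y\setminus D_Y$. Relevant space $(X,\le,R,{}',I,\tau)$: $(X,\le,\tau)$ Priestley, $R$ ternary, ${}'\colon X\to X$, $I\subseteq X$, where for $U,V\subseteq X$, $U\odot V=\{z:\exists x\in U,y\in V,\ Rxyz\}$ and $U\Rightarrow V=\{x:\forall y,z\,((Rxyz,\ y\in U)\Rightarrow z\in V)\}$; conditions: clopen up-sets are closed under $\odot,\Rightarrow$; $Rx_1y_1z_1$, $x_2\le x_1$, $y_2\le y_1$, $z_1\le z_2$ imply $Rx_2y_2z_2$; if not $Rxyz$ there are clopen up-sets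 $U\ni x$, $V\ni y$ with $z\notin U\odot V$; ${}'$ is continuous and antitone; $I$ is a clopen up-set and $y\le z$ iff $\exists x\in I$ with $Rxyz$. Relevant maps $\varphi$: continuous, isotone; $R_Xxyz\Rightarrow R_Y\varphi(x)\varphi(y)\varphi(z)$; $R_Yxy\varphi(z)\Rightarrow\exists u,v$, $R_Xuvz$, $x\le\varphi(u)$, $y\le\varphi(v)$; $R_Y\varphi(x)yz\Rightarrow\exists u,v$, $R_Xxuv$, $y\le\varphi(u)$, $\varphi(v)\le z$; $\varphi(x')=\varphi(x)'$; $\varphi^{-1}[I_Y]=I_X$. $\mathsf{SRS}$: Sugihara relevant spaces, i.e. relevant spaces (per Urquhart's correspondence: those with $x\odot y=y\odot x$, associativity of $\odot$, idempotence, $x''=x$, and $z\in x\odot y\Rightarrow y'\in x\odot z'$, where $x\odot y=\{z:Rxyz\}$) whose algebra of clopen up-sets $(X^*,\cap,\cup,\odot,\Rightarrow,I,\neg,\emptyset,X)$, $\neg U=\{x:x'\notin U\}$, is a bounded Sugihara monoid; morphisms are relevant maps. $(-)_{\bowtie}$: $\mathbf X\mapsto(I,\le\restriction_I,\{x\in X:x=x'\},$ subspace topology$)$, $\varphi\mapsto\varphi\restriction_I$. $(-)^{\bowtie}$: for $(X,\le,D,\tau)$ let $X^{\bowtie}=X\sqcup -(X\setminus D)$ (a disjoint formal copy); $-(-x)=x$, $-x=x$ for $x\in D$; order: on $X$ as $\le$; $-x\le -y$ iff $y\le x$; $-x\le y$ ($y\in X$) iff $x,y$ are $\le$-comparable;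 no $y\le -x$ with $y\in X$, $-x\notin X$ unless forced by these rules. Topology: disjoint union with $-(X\setminus D)$ a copy of the subspace $X\setminus D$. $|x|=x$ for $x\in X$, $|-x|=x$. Partial product: $x\cdot y=x\vee y$ if ($x,y\in X$ or $x,y$ incomparable) and the join exists; $=y$ if comparable and $|x|<|y|$; $=x$ if comparable and $|y|<|x|$; $=x\wedge y$ if comparable and $|x|=|y|$; undefined otherwise. $Rxyz$ iff $x\cdot y$ is defined and $x\cdot y\le z$. $\mathbf X^{\bowtie}=(X^{\bowtie},\le,R,-,X,\tau^{\bowtie})$; for morphisms $\varphi^{\bowtie}(x)=\varphi(x)$ if $x\in X$ and $-\varphi(-x)$ otherwise. *)

(* Defs.v *)
From HB Require Import structures.
From mathcomp Require Import all_boot all_classical topology.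

Set Implicit Arguments.
Unset Strict Implicit.
Unset Printing Implicit Defensive.

Local Open Scope classical_set_scope.

(** * Categories *)

Record category := Category {
  obj :> Type;
  hom : obj -> obj -> Type;
  idm : forall X, hom X X;
  compm : forall X Y Z, hom Y Z -> hom X Y -> hom X Z;
  compm1 : forall X Y (f : hom X Y), compm f (idm X) = f;
  comp1m : forall X Y (f : hom X Y), compm (idm Y) f = f;
  compmA : forall W X Y Z (h : hom Y Z) (g : hom X Y) (f : hom W X),
    compm h (compm g f) = compm (compm h g) f }.

Arguments hom {c}.
Arguments idm {c} X.
Arguments compm {c X Y Z}.

(* The data of a functor; functoriality is [is_functor]. *)
Record prefunctor (C D : category) := Prefunctor {
  fobj :> C -> D;
  fmap : forall X Y : C, hom X Y -> hom (fobj X) (fobj Y) }.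

Arguments Prefunctor {C D}.
Arguments fmap {C D} F {X Y} : rename.

Definition is_functor (C D : category) (F : prefunctor C D) : Prop :=
  (forall X : C, fmap F (idm X) = idm (F X)) /\
  (forall (X Y Z : C) (g : hom Y Z) (f : hom X Y),
     fmap F (compm g f) = compm (fmap F g) (fmap F f)).

Definition id_functor (C : category) : prefunctor C C :=
  Prefunctor (fun X : C => X) (fun X Y f => f).

Definition comp_functor (B C D : category)
    (G : prefunctor C D) (F : prefunctor B C) : prefunctor B D :=
  Prefunctor (fun X : B => G (F X)) (fun X Y f => fmap G (fmap F f)).

Definition is_iso (C : category) (X Y : C) (f : hom X Y) : Prop :=
  exists g : hom Y X, compm g f = idm X /\ compm f g = idm Y.

Definition naturally_isomorphic (C D : category) (F G : prefunctor C D) : Prop :=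
  exists eta : forall X : C, hom (F X) (G X),
    (forall X, is_iso (eta X)) /\
    (forall (X Y : C) (f : hom X Y),
       compm (eta Y) (fmap F f) = compm (fmap G f) (eta X)).

Definition equivalence_of_categories (C D : category)
    (F : prefunctor C D) (G : prefunctor D C) : Prop :=
  [/\ is_functor F, is_functor G,
      naturally_isomorphic (comp_functor G F) (id_functor C) &
      naturally_isomorphic (comp_functor F G) (id_functor D)].

(** * Ordered spaces *)

Section orders.
Context {T : Type} (le : T -> T -> Prop).

Definition partial_order :=
  [/\ (forall x, le x x),
      (forall x y, le x y -> le y x -> x = y) &
      (forall x y z, le x y -> le y z -> le x z)].

Definition up_set (U : set T) := forall x y, le x y -> U x -> U y.
Definition down_closure (U : set T) : set T := [set x | exists2 y, U y & le x y].
Definition comparable_by (x y : T) := le x y \/ le y x.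
Definition strictly (x y : T) := le x y /\ x <> y.

Definition is_join (x y w : T) :=
  [/\ le x w, le y w & forall z, le x z -> le y z -> le w z].
Definition is_meet (x y w : T) :=
  [/\ le w x, le w y & forall z, le z x -> le z y -> le z w].

End orders.

Section ordered_spaces.
Context {X : topologicalType} (le : X -> X -> Prop).

Definition clopen_up_set : set (set X) := [set U | clopen U /\ up_set le U].

Definition priestley_space :=
  [/\ compact [set: X], partial_order le &
      forall x y, ~ le x y -> exists U, [/\ clopen_up_set U, U x & ~ U y]].

Definition esakia_space :=
  priestley_space /\ forall U : set X, clopen U -> clopen (down_closure le U).

End ordered_spaces.

(** * Unpointed Sugihara spaces *)

Record sugihara_frame := SugiharaFrame {
  ss_car :> topologicalType;
  ss_le : ss_car -> ss_car -> Prop;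
  ss_D : set ss_car }.

Arguments ss_le {s}.
Arguments ss_D : clear implicits.

Definition unpointed_sugihara_space (X : sugihara_frame) : Prop :=
  let Q := comparable_by (@ss_le X) in
  [/\ esakia_space (@ss_le X),
      clopen (ss_D X),
      (forall x : X, Q x x),
      (forall x y : X, Q x y -> ss_D X x -> ss_le x y) &
      (forall x y z : X, Q x y -> ss_le y z -> Q z x)].

Record sugihara_space_map (X Y : sugihara_frame) (f : X -> Y) : Prop :=
  SugiharaSpaceMap {
    ssm_continuous : continuous f;
    ssm_isotone : forall x y : X, ss_le x y -> ss_le (f x) (f y);
    ssm_back : forall (x : X) (z : Y), ss_le (f x) z ->
      exists2 y : X, ss_le x y & f y = z;
    ssm_D : forall x : X, ss_D X x -> ss_D Y (f x);
    ssm_DC : forall x : X, ~ ss_D X x -> ~ ss_D Y (f x) }.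

Record SS_obj := SSObj {
  ss_str :> sugihara_frame;
  ss_strP : unpointed_sugihara_space ss_str }.

Record SS_hom (X Y : SS_obj) := SSHom {
  ss_fun :> X -> Y;
  ss_funP : sugihara_space_map ss_fun }.

Lemma SS_hom_eq (X Y : SS_obj) (f g : SS_hom X Y) :
  (f : X -> Y) = g -> f = g.
Proof.
by case: f g => [f fP] [g gP] /= fg; subst g; congr SSHom; exact: Prop_irrelevance.
Qed.

Lemma SS_id_subproof (X : SS_obj) : sugihara_space_map (@id X).
Proof. by split=> // [x|x z xz]; [exact: cvg_id|exists z]. Qed.

Lemma SS_comp_subproof (X Y Z : SS_obj) (g : SS_hom Y Z) (f : SS_hom X Y) :
  sugihara_space_map (g \o f).
Proof.
case: f g => [f [fc fi fb fD fDC]] [g [gc gi gb gD gDC]] /=; split=> /=.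
- by move=> x; apply: continuous_comp; [exact: fc|exact: gc].
- by move=> x y /fi/gi.
- by move=> x z /gb[y /fb[x' xx' <-] <-]; exists x'.
- by move=> x /fD/gD.
- by move=> x /fDC/gDC.
Qed.

Definition SS : category.
Proof.
refine (@Category SS_obj SS_hom (fun X => SSHom (SS_id_subproof X))
  (fun X Y Z g f => SSHom (SS_comp_subproof g f)) _ _ _) => *; exact: SS_hom_eq.
Defined.

(** * Relevant spaces *)

Record relevant_frame := RelevantFrame {
  rs_car :> topologicalType;
  rs_le : rs_car -> rs_car -> Prop;
  rs_R : rs_car -> rs_car -> rs_car -> Prop;
  rs_inv : rs_car -> rs_car;
  rs_I : set rs_car }.

Arguments rs_le {r}.
Arguments rs_R {r}.
Arguments rs_inv {r}.
Arguments rs_I : clear implicits.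

Section relevant_space.
Context (X : relevant_frame).

Definition rs_mul (U V : set X) : set X :=
  [set z | exists x y, [/\ U x, V y & rs_R x y z]].

Definition rs_imp (U V : set X) : set X :=
  [set x | forall y z, rs_R x y z -> U y -> V z].

Definition rs_neg (U : set X) : set X := [set x | ~ U (rs_inv x)].

Definition dual_carrier : set (set X) := clopen_up_set (@rs_le X).

Record relevant_space : Prop := RelevantSpace {
  rs_priestley : priestley_space (@rs_le X);
  rs_mul_closed : forall U V, dual_carrier U -> dual_carrier V ->
    dual_carrier (rs_mul U V);
  rs_imp_closed : forall U V, dual_carrier U -> dual_carrier V ->
    dual_carrier (rs_imp U V);
  rs_R_mono : forall x1 x2 y1 y2 z1 z2 : X, rs_R x1 y1 z1 ->
    rs_le x2 x1 -> rs_le y2 y1 -> rs_le z1 z2 -> rs_R x2 y2 z2;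
  rs_R_sep : forall x y z : X, ~ rs_R x y z -> exists U V,
    [/\ dual_carrier U, dual_carrier V, U x, V y & ~ rs_mul U V z];
  rs_inv_continuous : continuous (@rs_inv X);
  rs_inv_antitone : forall x y : X, rs_le x y -> rs_le (rs_inv y) (rs_inv x);
  rs_I_clopen_up : dual_carrier (rs_I X);
  rs_I_unit : forall y z : X, rs_le y z <-> exists2 x, rs_I X x & rs_R x y z }.

End relevant_space.

Arguments dual_carrier : clear implicits.

(* The algebra whose universe is the subset [A] of [T]. *)
Record bounded_sugihara_monoid (T : Type) (A : set T)
    (meet join mul imp : T -> T -> T) (t : T) (neg : T -> T) (bot top : T) : Prop :=
  BoundedSugiharaMonoid {
    bsm_closed2 : forall a b, A a -> A b ->
      [/\ A (meet a b), A (join a b), A (mul a b) & A (imp a b)];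
    bsm_closed1 : forall a, A a -> A (neg a);
    bsm_closed0 : [/\ A t, A bot & A top];
    bsm_meetC : forall a b, A a -> A b -> meet a b = meet b a;
    bsm_joinC : forall a b, A a -> A b -> join a b = join b a;
    bsm_meetA : forall a b c, A a -> A b -> A c ->
      meet a (meet b c) = meet (meet a b) c;
    bsm_joinA : forall a b c, A a -> A b -> A c ->
      join a (join b c) = join (join a b) c;
    bsm_meetK : forall a b, A a -> A b -> meet a (join a b) = a;
    bsm_joinK : forall a b, A a -> A b -> join a (meet a b) = a;
    bsm_meetD : forall a b c, A a -> A b -> A c ->
      meet a (join b c) = join (meet a b) (meet a c);
    bsm_bot : forall a, A a -> meet bot a = bot;
    bsm_top : forall a, A a -> meet a top = a;
    bsm_mulC : forall a b, A a -> A b -> mul a b = mul b a;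
    bsm_mulA : forall a b c, A a -> A b -> A c ->
      mul a (mul b c) = mul (mul a b) c;
    bsm_mul1 : forall a, A a -> mul t a = a;
    bsm_mulI : forall a, A a -> mul a a = a;
    bsm_residuation : forall a b c, A a -> A b -> A c ->
      meet (mul a b) c = mul a b <-> meet a (imp b c) = a;
    bsm_negK : forall a, A a -> neg (neg a) = a;
    bsm_contraposition : forall a b, A a -> A b ->
      imp a (neg b) = imp b (neg a) }.

Definition dual_is_sugihara (X : relevant_frame) : Prop :=
  bounded_sugihara_monoid (dual_carrier X) setI setU (@rs_mul X) (@rs_imp X)
    (rs_I X) (@rs_neg X) set0 setT.

Definition sugihara_relevant_space (X : relevant_frame) : Prop :=
  relevant_space X /\ dual_is_sugihara X.

(* Urquhart's first-order correspondents of the Sugihara monoid laws, with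
   x (.) y := [set z | rs_R x y z].  Idempotence of (.) is taken on up-sets. *)
Record urquhart_conditions (X : relevant_frame) : Prop := UrquhartConditions {
  uc_comm : forall x y z : X, rs_R x y z <-> rs_R y x z;
  uc_assoc : forall x y z : X,
    rs_mul [set u | rs_R x y u] [set z] = rs_mul [set x] [set v | rs_R y z v];
  uc_idem : forall U : set X, up_set (@rs_le X) U -> rs_mul U U = U;
  uc_invK : forall x : X, rs_inv (rs_inv x) = x;
  uc_contra : forall x y z : X, rs_R x y z -> rs_R x (rs_inv z) (rs_inv y) }.

Section correspondence.
Context (X : relevant_frame) (Xrs : relevant_space X).

Local Notation A := (dual_carrier X).

Let le_refl (x : X) : rs_le x x.
Proof. by have [_ [+ _ _] _] := rs_priestley Xrs; apply. Qed.

Lemma dual_carrier_neg (U : set X) : A U -> A (rs_neg U).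
Proof.
move=> [cU uU]; split.
  rewrite (_ : rs_neg U = ~` (rs_inv @^-1` U)); last by [].
  apply: clopenC => //; apply: preimage_clopen => //; exact: rs_inv_continuous.
by move=> x y xy nUx Uy; apply/nUx/(uU _ _ _ Uy); exact: rs_inv_antitone.
Qed.

Lemma dual_carrierI (U V : set X) : A U -> A V -> A (U `&` V).
Proof.
move=> [cU uU] [cV uV]; split; first exact: clopenI.
by move=> x y xy [/(uU _ _ xy) ? /(uV _ _ xy) ?].
Qed.

Lemma dual_carrierU (U V : set X) : A U -> A V -> A (U `|` V).
Proof.
move=> [cU uU] [cV uV]; split; first exact: clopenU.
by move=> x y xy [/(uU _ _ xy)|/(uV _ _ xy)] ?; [left|right].
Qed.

Lemma dual_carrierT : A setT.
Proof. by split=> //; exact: clopenT. Qed.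

Lemma dual_carrier0 : A set0.
Proof. by split=> //; exact: clopen0. Qed.

Lemma rs_le_sep (x y : X) :
  (forall U, A U -> U x -> U y) -> rs_le x y.
Proof.
move=> H; apply: contrapT => /(let: And3 _ _ h := rs_priestley Xrs in @h x y).
by move=> [U [AU Ux]]; apply; exact: H.
Qed.

Lemma rs_R_sepP (x y z : X) :
  rs_R x y z <-> forall U V, A U -> A V -> U x -> V y -> rs_mul U V z.
Proof.
split=> [Rxyz U V _ _ Ux Vy|H]; first by exists x, y.
apply: contrapT => /(rs_R_sep Xrs)[U [V [AU AV Ux Vy]]]; apply; exact: H.
Qed.

Lemma subset_meetE (U V : set X) : U `&` V = U <-> U `<=` V.
Proof. by split=> [/setIidPl|/setIidPl]. Qed.

Lemma rs_assoc_half (x y z w u : X) :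
  (forall U V W, A U -> A V -> A W ->
     rs_mul U (rs_mul V W) = rs_mul (rs_mul U V) W) ->
  rs_R x y u -> rs_R u z w -> exists2 v, rs_R y z v & rs_R x v w.
Proof.
move=> mulA Rxyu Ruzw.
pose D := [set p : set X * set X * set X |
  [/\ A p.1.1 /\ p.1.1 x, A p.1.2 /\ p.1.2 y & A p.2 /\ p.2 z]].
pose K (p : set X * set X * set X) := [set v |
  rs_mul p.1.2 p.2 v /\ exists2 a, p.1.1 a & rs_R a v w].
have K0 p : D p -> K p !=set0.
  move=> [[Ap px] [Aq qy] [Ar rz]].
  have : rs_mul p.1.1 (rs_mul p.1.2 p.2) w.
    by rewrite mulA//; exists u, z; split=> //; exists x, y.
  by move=> [a [v [pa qv Ravw]]]; exists v; split=> //; exists a.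
have FF : ProperFilter (filter_from D K).
  apply: filter_from_proper => //; apply: filter_from_filter.
    by exists (setT, setT, setT); split; split=> //; exact: dual_carrierT.
  move=> p q [[Ap1 p1] [Ap2 p2] [Ap3 p3]] [[Aq1 q1] [Aq2 q2] [Aq3 q3]].
  exists (p.1.1 `&` q.1.1, p.1.2 `&` q.1.2, p.2 `&` q.2).
    by split; split=> //; exact: dual_carrierI.
  move=> v [[b [c [[? ?] [? ?] Rbcv]]] [a [? ?] ?]].
  by split; (split; [exists b, c|exists a]).
have [cX _ _] := rs_priestley Xrs.
have [|v [_ clv]] := cX _ FF; first exact: filterT.
have KF U V W : A U -> A V -> A W -> U x -> V y -> W z ->
    filter_from D K (K (U, V, W)).
  by move=> *; exists (U, V, W).
exists v.
- apply/rs_R_sepP => V W AV AW Vy Wz; apply: contrapT => nVWv.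
  have [[_ cVW] _] := rs_mul_closed Xrs AV AW.
  have nb : nbhs v (~` rs_mul V W).
    by apply: open_nbhs_nbhs; split=> //; exact: closed_openC.
  have [t [[+ _]]] := clv _ _ (KF setT V W dual_carrierT AV AW I Vy Wz) nb.
  by move=> /= ?; apply.
- apply/rs_R_sepP => U V AU AV Ux Vv.
  have nb : nbhs v V by apply: open_nbhs_nbhs; split=> //; case: AV => -[].
  have [t [[_ [a Ua Rat]] Vt]] :=
    clv _ _ (KF U setT setT AU dual_carrierT dual_carrierT Ux I I) nb.
  by exists a, t.
Qed.

Lemma urquhart_correspondence : dual_is_sugihara X <-> urquhart_conditions X.
Proof.
have mulS (U U' V V' : set X) :
    U `<=` U' -> V `<=` V' -> rs_mul U V `<=` rs_mul U' V'.
  by move=> UU VV z [x [y [/UU ? /VV ? ?]]]; exists x, y.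
split=> [S|[comm assoc idem invK contra]].
- have comm (x y z : X) : rs_R x y z -> rs_R y x z.
    move=> Rxyz; apply/rs_R_sepP => U V AU AV Uy Vx.
    by rewrite (bsm_mulC S)//; exists x, y.
  have inv_le (x : X) : rs_le x (rs_inv (rs_inv x)) /\ rs_le (rs_inv (rs_inv x)) x.
    have E U : A U -> U (rs_inv (rs_inv x)) <-> U x.
      move=> AU; rewrite -{2}(bsm_negK S AU) /rs_neg /=; split; first by move=> ?; apply.
      exact: contrapT.
    by split; apply: rs_le_sep => U AU; rewrite E.
  have mulA := bsm_mulA S.
  split.
  + by move=> x y z; split; exact: comm.
  + move=> x y z; apply/seteqP; split=> w.
      move=> [u [_ [/= Rxyu -> Ruzw]]].
      have [v ? ?] := rs_assoc_half mulA Rxyu Ruzw.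
      by exists x, v.
    move=> [_ [v [/= -> Ryzv Rxvw]]].
    have [u Ru Ruw] := rs_assoc_half mulA (comm _ _ _ Ryzv) (comm _ _ _ Rxvw).
    by exists u, z; split=> //; exact: comm.
  + move=> U uU; apply/seteqP; split=> z.
      move=> [x [y [Ux Uy Rxyz]]]; apply: contrapT => nUz.
      have nle u : U u -> ~ rs_le u z by move=> ? /uU; auto.
      have [_ _ sep] := rs_priestley Xrs.
      have [V [AV Vx nVz]] := sep _ _ (nle _ Ux).
      have [W [AW Wy nWz]] := sep _ _ (nle _ Uy).
      have : rs_mul (V `|` W) (V `|` W) z by exists x, y; split=> //; [left|right].
      by rewrite (bsm_mulI S); [case|exact: dual_carrierU].
    move=> Uz; exists z, z; split=> //; apply/rs_R_sepP => V W AV AW Vz Wz.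
    apply: (mulS (V `&` W) _ (V `&` W)) => [t []//|t []//|].
    by rewrite (bsm_mulI S)//; exact: dual_carrierI.
  + move=> x; have [? ?] := inv_le x.
    by have [_ [_ + _] _] := rs_priestley Xrs; apply.
  + move=> x y z Rxyz; apply/rs_R_sepP => U V AU AV Ux Vz'.
    apply: contrapT => nUV.
    have AUV := rs_mul_closed Xrs AU AV.
    pose N := rs_neg (rs_mul U V); have AN : A N by exact: dual_carrier_neg.
    have AnV := dual_carrier_neg AV.
    suff : rs_mul U N `<=` rs_neg V.
      by move=> /(_ z); apply => //; exists x, y.
    rewrite (bsm_mulC S)//; apply/subset_meetE/(bsm_residuation S) => //.
    apply/subset_meetE => a Na; rewrite /rs_imp /= => b c Rabc Ub Vc.
    have I1 : rs_mul (rs_mul U V) (rs_I X) = rs_mul U V.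
      by rewrite (bsm_mulC S) ?(bsm_mul1 S)//; exact: (rs_I_clopen_up Xrs).
    have AI := rs_I_clopen_up Xrs.
    have : rs_imp (rs_I X) (rs_neg (rs_mul U V)) = rs_imp (rs_mul U V) (rs_neg (rs_I X)).
      exact: (bsm_contraposition S).
    have EN W : A W -> rs_imp (rs_I X) W = W.
      move=> AW; apply/seteqP; split=> d.
        move=> /= dIW; have : rs_mul (rs_imp (rs_I X) W) (rs_I X) d.
          by rewrite (bsm_mulC S) ?(bsm_mul1 S)//; exact: rs_imp_closed.
        by move=> [e [f [eI fI ?]]]; exact: eI fI.
      move=> Wd e f Rdef Ie.
      have : rs_mul W (rs_I X) f by exists d, e.
      by rewrite (bsm_mulC S)// (bsm_mul1 S).
    rewrite EN// => NE.
    have VE : rs_neg V = rs_imp V (rs_neg (rs_I X)).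
      by rewrite -(bsm_contraposition S)// EN.
    suff : rs_neg V c by [].
    rewrite VE /rs_imp /= => d e Rcde Vd.
    have aN : rs_imp (rs_mul U V) (rs_neg (rs_I X)) a by rewrite -NE.
    have [g Rbdg Rage] := rs_assoc_half mulA Rabc Rcde.
    by apply: (aN g e Rage); exists b, d.
- have neg2 (U : set X) : rs_neg (rs_neg U) = U.
    apply/seteqP; split=> x; rewrite /rs_neg /= invK; first exact: contrapT.
    by move=> ?; apply.
  have mulC (U V : set X) : rs_mul U V = rs_mul V U.
    by apply/seteqP; split=> z [x [y [? ? /comm ?]]]; exists y, x.
  have mulA (U V W : set X) : rs_mul U (rs_mul V W) = rs_mul (rs_mul U V) W.
    apply/seteqP; split=> w.
      move=> [x [v [Ux [y [z [Vy Wz Ryzv]]] Rxvw]]].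
      have : rs_mul [set x] [set v | rs_R y z v] w by exists x, v.
      rewrite -assoc => -[u [_ [/= Rxyu -> Ruzw]]].
      by exists u, z; split=> //; exists x, y.
    move=> [u [z [[x [y [Ux Vy Rxyu]]] Wz Ruzw]]].
    have : rs_mul [set u | rs_R x y u] [set z] w by exists u, z.
    rewrite assoc => -[_ [v [/= -> Ryzv Rxvw]]].
    by exists x, v; split=> //; exists y, z.
  have contraS (U V : set X) : rs_imp U (rs_neg V) `<=` rs_imp V (rs_neg U).
    move=> x H y z Rxyz Vy Uz'.
    by have /= := H _ _ (contra _ _ _ Rxyz) Uz'; rewrite /rs_neg /= invK; apply.
  split.
  + move=> U V AU AV; split; [exact: dual_carrierI|exact: dual_carrierU| |].
    * exact: rs_mul_closed.
    * exact: rs_imp_closed.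
  + exact: dual_carrier_neg.
  + by split; [exact: rs_I_clopen_up|exact: dual_carrier0|exact: dual_carrierT].
  + by move=> *; exact: setIC.
  + by move=> *; exact: setUC.
  + by move=> *; exact: setIA.
  + by move=> *; exact: setUA.
  + by move=> *; rewrite setIUr setIid; apply/setUidPl => ? [].
  + by move=> *; apply/setUidPl => ? [].
  + by move=> *; exact: setIUr.
  + by move=> *; exact: set0I.
  + by move=> *; exact: setIT.
  + by move=> *; exact: mulC.
  + by move=> *; exact: mulA.
  + move=> U [_ uU]; apply/seteqP; split=> z.
      by move=> [x [y [Ix Uy Rxyz]]]; apply: uU Uy; apply/(rs_I_unit Xrs); exists x.
    by move=> Uz; have /(rs_I_unit Xrs)[x ? ?] := le_refl z; exists x, z.
  + by move=> U [_ uU]; exact: idem.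
  + move=> U V W _ _ _; rewrite !subset_meetE; split=> H.
      by move=> x Ux y z Rxyz Vy; apply: H; exists x, y.
    by move=> z [x [y [Ux Vy Rxyz]]]; exact: (H x Ux y z).
  + by move=> *; exact: neg2.
  + by move=> U V _ _; apply/seteqP; split; exact: contraS.
Qed.

End correspondence.

Record relevant_map (X Y : relevant_frame) (f : X -> Y) : Prop := RelevantMap {
  rm_continuous : continuous f;
  rm_isotone : forall x y : X, rs_le x y -> rs_le (f x) (f y);
  rm_R : forall x y z : X, rs_R x y z -> rs_R (f x) (f y) (f z);
  rm_back_mul : forall (x y : Y) (z : X), rs_R x y (f z) ->
    exists u v : X, [/\ rs_R u v z, rs_le x (f u) & rs_le y (f v)];
  rm_back_imp : forall (x : X) (y z : Y), rs_R (f x) y z ->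
    exists u v : X, [/\ rs_R x u v, rs_le y (f u) & rs_le (f v) z];
  rm_inv : forall x : X, f (rs_inv x) = rs_inv (f x);
  rm_I : f @^-1` rs_I Y = rs_I X }.

Record SRS_obj := SRSObj {
  srs_str :> relevant_frame;
  srs_strP : sugihara_relevant_space srs_str }.

Record SRS_hom (X Y : SRS_obj) := SRSHom {
  srs_fun :> X -> Y;
  srs_funP : relevant_map srs_fun }.

Lemma SRS_hom_eq (X Y : SRS_obj) (f g : SRS_hom X Y) :
  (f : X -> Y) = g -> f = g.
Proof.
by case: f g => [f fP] [g gP] /= fg; subst g; congr SRSHom; exact: Prop_irrelevance.
Qed.

Lemma SRS_id_subproof (X : SRS_obj) : relevant_map (@id X).
Proof.
have [[[_ [lexx _ _] _] _ _ _ _ _ _ _ _] _] := srs_strP X.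
split=> //.
- by move=> x; exact: cvg_id.
- by move=> x y z Rxyz; exists x, y.
- by move=> x y z Rxyz; exists y, z.
Qed.

Lemma SRS_comp_subproof (X Y Z : SRS_obj) (g : SRS_hom Y Z) (f : SRS_hom X Y) :
  relevant_map (g \o f).
Proof.
have [[[_ [_ _ le_trans] _] _ _ _ _ _ _ _ _] _] := srs_strP Z.
case: f g => [f [fc fi fR fm fp fv fI]] [g [gc gi gR gm gp gv gI]] /=.
split=> /=.
- by move=> x; apply: continuous_comp; [exact: fc|exact: gc].
- by move=> x y /fi/gi.
- by move=> x y z /fR/gR.
- move=> x y z /gm[u [v [/fm[s [t [Rstz us vt]]] xu yv]]].
  by exists s, t; split=> //; [apply: le_trans xu _|apply: le_trans yv _]; exact: gi.
- move=> x y z /gp[u [v [/fp[s [t [Rxst us tv]]] yu vz]]].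
  exists s, t; split=> //; first by apply: le_trans yu _; exact: gi.
  by apply: le_trans vz; exact: gi.
- by move=> x; rewrite fv gv.
- by rewrite comp_preimage gI fI.
Qed.

Definition SRS : category.
Proof.
refine (@Category SRS_obj SRS_hom (fun X => SRSHom (SRS_id_subproof X))
  (fun X Y Z g f => SRSHom (SRS_comp_subproof g f)) _ _ _) => *; exact: SRS_hom_eq.
Defined.

(** * From relevant spaces to Sugihara spaces *)

Definition lower_bowtie (X : relevant_frame) : sugihara_frame :=
  @SugiharaFrame (set_type (rs_I X))
    (fun x y => rs_le (\val x) (\val y))
    [set x | \val x = rs_inv (\val x)].

Lemma relevant_map_I (X Y : relevant_frame) (f : X -> Y) (fP : relevant_map f)
  (x : rs_I X) : f (\val x) \in rs_I Y.
Proof. by have := valP x; rewrite !inE -{1}(rm_I fP). Qed.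

Definition lower_bowtie_map (X Y : SRS) (f : hom X Y) :
    lower_bowtie (srs_str X) -> lower_bowtie (srs_str Y) :=
  fun x => exist _ (srs_fun f (\val x)) (relevant_map_I (srs_funP f) x).

(** * From Sugihara spaces to relevant spaces *)

(* [inl x] is x itself and [inr x], for x outside D, is the formal copy -x. *)
Definition bowtie (X : sugihara_frame) : Type := (X + set_type (~` ss_D X))%type.

HB.instance Definition _ (X : sugihara_frame) := Choice.on (bowtie X).

Section bowtie_topology.
Context (X : sugihara_frame).

Definition bowtie_open : set_system (bowtie X) :=
  [set U | open ((inl : X -> bowtie X) @^-1` U) /\
           open ((inr : set_type (~` ss_D X) -> bowtie X) @^-1` U)].

Lemma bowtie_openT : bowtie_open setT.
Proof. by split; rewrite preimage_setT; exact: openT. Qed.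

Lemma bowtie_openI : setI_closed bowtie_open.
Proof.
by move=> U V [? ?] [? ?]; split; rewrite preimage_setI; exact: openI.
Qed.

Lemma bowtie_open_bigU (I : Type) (f : I -> set (bowtie X)) :
  (forall i, bowtie_open (f i)) -> bowtie_open (\bigcup_i f i).
Proof.
by move=> fo; split; rewrite preimage_bigcup; apply: bigcup_open => i _; case: (fo i).
Qed.

HB.instance Definition _ := isOpenTopological.Build (bowtie X)
  bowtie_openT bowtie_openI bowtie_open_bigU.

End bowtie_topology.

Section bowtie.
Context (X : sugihara_frame).

Definition bowtie_base : set (bowtie X) := range inl.

Definition bowtie_neg (u : bowtie X) : bowtie X :=
  match u with
  | inl x => oapp inr (inl x) (insub x)
  | inr x => inl (\val x)
  end.

Definition bowtie_abs (u : bowtie X) : X :=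
  match u with inl x => x | inr x => \val x end.

(* The rules for -x with x in D, where -x = x, are consequences: see
   [bowtie_le_neg] and [bowtie_le_neg_base]. *)
Definition bowtie_le (u v : bowtie X) : Prop :=
  match u, v with
  | inl x, inl y => ss_le x y
  | inr x, inr y => ss_le (\val y) (\val x)
  | inr x, inl y => comparable_by ss_le (\val x) y
  | inl _, inr _ => False
  end.

(* [bowtie_prod u v w] says that the partial product u . v is defined and
   equal to w; the clauses agree where they overlap. *)
Definition bowtie_prod (u v w : bowtie X) : Prop :=
  let comp := comparable_by bowtie_le u v in
  [\/ ((bowtie_base u /\ bowtie_base v) \/ ~ comp) /\ is_join bowtie_le u v w,
      [/\ comp, strictly ss_le (bowtie_abs u) (bowtie_abs v) & w = v],
      [/\ comp, strictly ss_le (bowtie_abs v) (bowtie_abs u) & w = u] |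
      [/\ comp, bowtie_abs u = bowtie_abs v & is_meet bowtie_le u v w]].

Definition bowtie_R (u v z : bowtie X) : Prop :=
  exists2 w, bowtie_prod u v w & bowtie_le w z.

Definition upper_bowtie : relevant_frame :=
  @RelevantFrame (bowtie X) bowtie_le bowtie_R bowtie_neg bowtie_base.

Lemma bowtie_neg_D (x : X) : ss_D X x -> bowtie_neg (inl x) = inl x.
Proof. by move=> Dx /=; rewrite insubF//; apply/negP; rewrite inE /=; exact. Qed.

Lemma bowtie_neg_DC (x : X) (nDx : x \in ~` ss_D X) :
  bowtie_neg (inl x) = inr (exist _ x nDx).
Proof. by rewrite /= insubT. Qed.

Lemma bowtie_negK : involutive bowtie_neg.
Proof.
move=> [x|[x nDx]]; last by rewrite /= insubT.
have [Dx|nDx] := pselect (ss_D X x); first by rewrite !bowtie_neg_D.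
by rewrite (bowtie_neg_DC (mem_set nDx)).
Qed.

Context (XP : unpointed_sugihara_space X).

Let D_minimal (x y : X) : ss_D X x -> ss_le y x -> y = x.
Proof.
have [[[_ [_ anti _] _] _] _ _ DQ _] := XP.
by move=> Dx yx; apply: anti => //; apply: DQ => //; right.
Qed.

Lemma bowtie_le_neg (x y : X) :
  bowtie_le (bowtie_neg (inl x)) (bowtie_neg (inl y)) <-> ss_le y x.
Proof.
have [[[_ [lexx _ _] _] _] _ _ DQ _] := XP.
have [Dx|nDx] := pselect (ss_D X x); have [Dy|nDy] := pselect (ss_D X y).
- rewrite !bowtie_neg_D//; split=> /= h.
  + by rewrite (D_minimal Dy h).
  + by rewrite (D_minimal Dx h).
- rewrite bowtie_neg_D// (bowtie_neg_DC (mem_set nDy)); split=> //= h.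
  by apply: nDy; rewrite (D_minimal Dx h).
- rewrite (bowtie_neg_D Dy) (bowtie_neg_DC (mem_set nDx)); split=> //= h.
  + by apply: DQ Dy; case: h; [right|left].
  + by right.
- by rewrite (bowtie_neg_DC (mem_set nDx)) (bowtie_neg_DC (mem_set nDy)).
Qed.

Lemma bowtie_le_neg_base (x y : X) :
  bowtie_le (bowtie_neg (inl x)) (inl y) <-> comparable_by ss_le x y.
Proof.
have [_ _ _ DQ _] := XP.
have [Dx|nDx] := pselect (ss_D X x); last by rewrite (bowtie_neg_DC (mem_set nDx)).
by rewrite bowtie_neg_D//=; split=> [|/DQ]; [left|exact].
Qed.

End bowtie.

Definition upper_bowtie_map (X Y : SS) (f : hom X Y) :
    upper_bowtie (ss_str X) -> upper_bowtie (ss_str Y) :=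
  fun u : bowtie (ss_str X) => match u with
  | inl x => inl (ss_fun f x)
  | inr x => bowtie_neg (inl (ss_fun f (\val x)))
  end.

(* Main.v *)
From mathcomp Require Import all_boot all_classical topology.
Require Import Defs.

Set Implicit Arguments.
Unset Strict Implicit.
Unset Printing Implicit Defensive.

Local Open Scope classical_set_scope.

(** In both directions the ternary relation reduces to the order on absolute
    values.  Say that [u] dominates [v] and [w] if [u] has the form -|u| and
    |v|, |w| <= |u|.  Then [R u v z] holds iff one of [u], [v], -[z] dominates
    the other two: for X^bowtie this follows from the definition of the partial
    product (joins exist because common upper bounds form closed chains), and for
    a Sugihara relevant space from idempotence, contraposition and two uses of
    associativity.  The description is symmetric in [u], [v], -[z], so in
    X^bowtie commutativity and contraposition are immediate, associativity follows
    from the four-element analogue of domination, and the product of clopen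
    up-sets is a union of down-closures of clopen sets, hence clopen by the
    Esakia condition.  It also shows that the bijection from (I)^bowtie to X
    sending x to x and -x to x' respects [R], and [R] determines the order. *)

(** * Topological preliminaries *)

Section set_type_topology.
Context {X : topologicalType} (A : set X).

Lemma set_typeP (x : A) : A (\val x).
Proof. exact: (set_mem (valP x)). Qed.

Lemma set_val_continuous : continuous (\val : A -> X).
Proof. exact: (@initial_continuous A X \val). Qed.

Lemma set_type_open (U : set A) :
  open U <-> exists2 W : set X, open W & U = \val @^-1` W.
Proof. by split=> [[W oW <-]|[W oW ->]]; exists W. Qed.

(** The filter is pushed forward along the inclusion. Its cluster point lies in [A], and open sets
    of the subspace are traces of open sets of [X]. *)
Lemma set_type_compact : compact [set: X] -> closed A -> compact [set: A].
Proof.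
move=> cX clA F FF _.
have cA : compact A by exact: (subclosed_compact clA cX).
have FA : (\val @ F) A.
  by apply: (@filterS _ F _ setT) => [x _|]; [exact: set_typeP|exact: filterT].
have [x [Ax clx]] := cA _ _ FA.
exists (exist _ x (mem_set Ax)); split=> // P B FP.
rewrite nbhsE => -[_ [[W oW <-] Wx] WB].
have [_ [[p Pp <-] Wp]] : (\val @` P `&` W) !=set0.
  apply: clx; first by apply: (@filterS _ F _ P) => // p Pp; exists p.
  exact: open_nbhs_nbhs.
by exists p; split=> //; exact: WB.
Qed.

Lemma open_set_type_image (U : set A) : open A -> open U -> open (\val @` U).
Proof.
move=> oA /set_type_open[W oW ->].
have -> : \val @` (\val @^-1` W : set A) = W `&` A; last exact: openI.
apply/seteqP; split=> [_ [x Wx <-]|x [Wx Ax]]; first by split=> //; exact: set_typeP.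
by exists (exist _ x (mem_set Ax)).
Qed.

(** The complement of the image is the image of the complement together with the complement of
    [A]. *)
Lemma clopen_set_type_image (U : set A) :
  clopen A -> clopen U -> clopen (\val @` U).
Proof.
move=> [oA clA] [oU clU]; split; first exact: open_set_type_image.
rewrite -openC.
have -> : ~` (\val @` U) = \val @` (~` U) `|` ~` A.
  apply/seteqP; split=> [x nUx|x].
    have [Ax|nAx] := pselect (A x); last by right.
    left; exists (exist _ x (mem_set Ax)) => //= Ux; apply: nUx.
    by exists (exist _ x (mem_set Ax)).
  move=> [[y nUy <-] [z Uz /val_inj zy]|nAx [y Uy yx]].
    by apply: nUy; rewrite -zy.
  by apply: nAx; rewrite -yx; exact: set_typeP.
by apply: openU; [apply: open_set_type_image => //; exact: closed_openC|exact: closed_openC].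
Qed.

End set_type_topology.

(** Such a family is the base of a proper filter, and a cluster point of the filter lies in every
    closed member. The points found by compactness below come from this form. *)
Lemma compact_directed_cap (X : topologicalType) (B : set (set X)) :
  compact [set: X] -> B !=set0 ->
  (forall U, B U -> closed U /\ U !=set0) ->
  (forall U V, B U -> B V -> exists2 W, B W & W `<=` U `&` V) ->
  exists x, forall U, B U -> U x.
Proof.
move=> cX B0 Bcl BI.
have FF : ProperFilter (filter_from B id).
  apply: filter_from_proper; last by move=> U /Bcl[].
  by apply: filter_from_filter.
have [|x [_ clx]] := cX _ FF; first exact: filterT.
exists x => U BU; have [clU _] := Bcl _ BU.
by apply: clU => V nV; apply: clx => //; exists U.
Qed.

(** * Clopen up-sets and Priestley spaces *)

Section clopen_up_sets.
Context {X : topologicalType} (le : X -> X -> Prop).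
Local Notation A := (clopen_up_set le).

Lemma clopen_up_setI (U V : set X) : A U -> A V -> A (U `&` V).
Proof.
move=> [cU uU] [cV uV]; split; first exact: clopenI.
by move=> x y xy [/(uU _ _ xy) ? /(uV _ _ xy) ?].
Qed.

Lemma clopen_up_setU (U V : set X) : A U -> A V -> A (U `|` V).
Proof.
move=> [cU uU] [cV uV]; split; first exact: clopenU.
by move=> x y xy [/(uU _ _ xy)|/(uV _ _ xy)] ?; [left|right].
Qed.

Lemma clopen_up_setT : A setT.
Proof. by split=> //; exact: clopenT. Qed.

Lemma clopen_up_set0 : A set0.
Proof. by split=> //; exact: clopen0. Qed.

End clopen_up_sets.

Lemma clopen_setD (X : topologicalType) (U V : set X) :
  clopen U -> clopen V -> clopen (U `\` V).
Proof. by move=> cU cV; rewrite setDE; apply: clopenI => //; exact: clopenC. Qed.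

Section priestley.
Context {X : topologicalType} (le : X -> X -> Prop) (PX : priestley_space le).
Local Notation A := (clopen_up_set le).

Lemma priestley_le (x y : X) : (forall U, A U -> U x -> U y) -> le x y.
Proof.
have [_ _ sep] := PX.
move=> H; apply: contrapT => /sep[U [AU Ux]]; apply; exact: H.
Qed.

(** A principal up-set is the intersection of the clopen up-sets containing its least element. *)
Lemma priestley_closed_up (x : X) : closed [set y | le x y].
Proof.
move=> y cly; apply: priestley_le => U AU Ux; apply: contrapT => nUy.
have [[_ clU] uU] := AU.
have nb : nbhs y (~` U) by apply: open_nbhs_nbhs; split=> //; exact: closed_openC.
by have [z [/= xz]] := cly _ nb; apply; exact: uU xz Ux.
Qed.

Lemma priestley_closed_down (x : X) : closed [set y | le y x].
Proof.
move=> y cly; apply: priestley_le => U AU Uy; apply: contrapT => nUx.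
have [[oU _] uU] := AU.
by have [|z [/= zx Uz]] := cly U; [exact: open_nbhs_nbhs|apply/nUx/(uU _ _ zx)].
Qed.

(** Every clopen up-set around a point [x] of the closure meets [K]. Compactness gives one [k] in
    [K] lying in all of them, hence above [x]. *)
Lemma priestley_down_closed (K : set X) : closed K -> closed (down_closure le K).
Proof.
have [cX _ _] := PX => clK x clx.
have [k Bk] : exists k, forall V, [set U `&` K | U in [set U | A U /\ U x]] V -> V k.
  apply: compact_directed_cap => //.
  - by exists (setT `&` K), setT => //; split=> //; exact: clopen_up_setT.
  - move=> _ [U [AU Ux] <-]; have [[oU clU] uU] := AU.
    split; first exact: closedI.
    have [|y [[k Kk yk] Uy]] := clx U; first exact: open_nbhs_nbhs.
    by exists k; split=> //; exact: uU yk Uy.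
  - move=> _ _ [U [AU Ux] <-] [V [AV Vx] <-].
    exists ((U `&` V) `&` K); last by move=> z [[? ?] ?].
    by exists (U `&` V) => //; split=> //; exact: clopen_up_setI.
have BE U : A U -> U x -> (U `&` K) k by move=> AU Ux; apply: Bk; exists U.
exists k; first by case: (BE setT) => //; exact: clopen_up_setT.
by apply: priestley_le => U AU Ux; case: (BE U).
Qed.

(** If no difference around [x] fits into [O], the parts of the differences outside [O] have a
    common point [w]. It lies in the same clopen up-sets as [x], so [w] is [x], which contradicts
    [O x]. *)
Lemma priestley_clopen_base (O : set X) (x : X) : open O -> O x ->
  exists U V, [/\ A U, A V, U x, ~ V x & U `\` V `<=` O].
Proof.
have [cX [_ anti _] _] := PX => oO Ox; apply: contrapT => noUV.
pose B := [set P : set X | exists U V,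
  [/\ A U, A V, U x, ~ V x & P = (U `\` V) `\` O]].
have [w Bw] : exists w, forall P, B P -> P w.
  apply: compact_directed_cap => //.
  - exists ((setT `\` set0) `\` O), setT, set0.
    by split=> //; [exact: clopen_up_setT|exact: clopen_up_set0].
  - move=> _ [U [V [AU AV Ux nVx ->]]]; split.
      rewrite [_ `\` O]setDE; apply: closedI; last exact: open_closedC.
      by case: AU AV => [cU _] [cV _]; case: (clopen_setD cU cV).
    apply: contrapT => /set0P/negP; rewrite negbK => /eqP UVO.
    apply: noUV; exists U, V; split=> // z UVz; apply: contrapT => nOz.
    by have : set0 z by rewrite -UVO.
  - move=> _ _ [U [V [AU AV Ux nVx ->]]] [U' [V' [AU' AV' Ux' nVx' ->]]].
    exists (((U `&` U') `\` (V `|` V')) `\` O).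
      exists (U `&` U'), (V `|` V'); split=> //; first exact: clopen_up_setI.
        exact: clopen_up_setU.
      by case.
    by move=> z [[[? ?] nVV] ?]; split; (split=> //; split=> // ?; apply: nVV); [left|right].
have BE U V : A U -> A V -> U x -> ~ V x -> ((U `\` V) `\` O) w.
  by move=> *; apply: Bw; exists U, V.
have [[_ _] nOw] := BE _ _ (clopen_up_setT le) (clopen_up_set0 le) I id.
have xw : x = w.
  apply: anti; apply: priestley_le => U AU Ux.
    by have [[]] := BE _ _ AU (clopen_up_set0 le) Ux id.
  apply: contrapT => nUx.
  by have [[_ +] _] := BE _ _ (clopen_up_setT le) AU I nUx.
by apply: nOw; rewrite -xw.
Qed.

(* The clopen differences [U `\` V] form a base, so it is enough to test the
   Esakia condition on them. *)
Lemma esakia_of_differences :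
  (forall U V, A U -> A V -> open (down_closure le (U `\` V))) -> esakia_space le.
Proof.
move=> oUV; split=> // K [oK clK]; split; last exact: priestley_down_closed.
rewrite openE => x [k Kk xk].
have [U [V [AU AV Uk nVk UVK]]] := priestley_clopen_base oK Kk.
rewrite /interior nbhsE; exists (down_closure le (U `\` V)).
  by split; [exact: oUV|exists k].
by move=> y [l UVl yl]; exists l => //; exact: UVK.
Qed.

End priestley.

(** * Sugihara relevant spaces *)

Lemma comparable_by_sym (T : Type) (le : T -> T -> Prop) (x y : T) :
  comparable_by le x y -> comparable_by le y x.
Proof. by case; [right|left]. Qed.

(** * Order and ternary relation on the points *)

Section sugihara_relevant_space_theory.
Context (X : relevant_frame) (XP : sugihara_relevant_space X).

Local Notation "x <=r y" := (rs_le x y) (at level 70).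
Local Notation "x ^*" := (rs_inv x).
Local Notation I := (rs_I X).

Let Xrs : relevant_space X. Proof. by case: XP. Qed.
Let Xuc : urquhart_conditions X.
Proof. by case: XP => rsX /(urquhart_correspondence rsX). Qed.

Lemma srs_lexx (x : X) : x <=r x.
Proof. by have [_ [+ _ _] _] := rs_priestley Xrs; apply. Qed.

Lemma srs_le_anti (x y : X) : x <=r y -> y <=r x -> x = y.
Proof. by have [_ [_ + _] _] := rs_priestley Xrs; apply. Qed.

Lemma srs_le_trans (y x z : X) : x <=r y -> y <=r z -> x <=r z.
Proof. by have [_ [_ _ +] _] := rs_priestley Xrs; apply. Qed.

Lemma srs_invK (x : X) : x^*^* = x.
Proof. exact: uc_invK. Qed.

Lemma srs_le_inv (x y : X) : x <=r y -> y^* <=r x^*.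
Proof. exact: rs_inv_antitone. Qed.

Lemma srs_I_up (x y : X) : x <=r y -> I x -> I y.
Proof. by have [_ +] := rs_I_clopen_up Xrs; apply. Qed.

Lemma srs_RC (x y z : X) : rs_R x y z -> rs_R y x z.
Proof. by move=> /(uc_comm Xuc). Qed.

Lemma srs_contra (x y z : X) : rs_R x y z -> rs_R x z^* y^*.
Proof. exact: uc_contra. Qed.

Lemma srs_assoc (x y z u w : X) :
  rs_R x y u -> rs_R u z w -> exists2 v, rs_R y z v & rs_R x v w.
Proof.
move=> Rxyu Ruzw.
have : rs_mul [set u | rs_R x y u] [set z] w by exists u, z.
by rewrite (uc_assoc Xuc) => -[_ [v [/= -> ? ?]]]; exists v.
Qed.

(** Idempotence for the up-set generated by [x] and [y]. *)
Lemma srs_R_le (x y z : X) : rs_R x y z -> x <=r z \/ y <=r z.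
Proof.
move=> Rxyz.
have uU : up_set (@rs_le X) [set w | x <=r w \/ y <=r w].
  by move=> a b ab [/= h|h]; [left|right]; exact: srs_le_trans h ab.
have : rs_mul [set w | x <=r w \/ y <=r w] [set w | x <=r w \/ y <=r w] z.
  by exists x, y; split=> //; [left|right]; exact: srs_lexx.
by rewrite (uc_idem Xuc).
Qed.

(** By idempotence of the principal up-set of [z], some [a], [b] above [z] satisfy [R a b z]; now
    lower [a] and [b]. *)
Lemma srs_le_R (x y z : X) : x <=r z -> y <=r z -> rs_R x y z.
Proof.
move=> xz yz.
have uU : up_set (@rs_le X) [set w | z <=r w].
  by move=> a b ab /= h; exact: srs_le_trans h ab.
have : [set w | z <=r w] z by exact: srs_lexx.
rewrite -{1}(uc_idem Xuc uU) => -[a [b [/= za zb Rabz]]].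
by apply: (rs_R_mono Xrs Rabz) (srs_lexx z);
  [exact: srs_le_trans xz za|exact: srs_le_trans yz zb].
Qed.

Lemma srs_I_R (x y z : X) : I x -> rs_R x y z -> y <=r z.
Proof. by move=> Ix Rxyz; apply/(rs_I_unit Xrs); exists x. Qed.

(** From [R i x x] with [i] in [I], commutativity and contraposition give R x x' i', and idempotence
    puts [x] or x' below i'. *)
Lemma srs_I_total (x : X) : I x \/ I x^*.
Proof.
have /(rs_I_unit Xrs)[i Ii /srs_RC/srs_contra/srs_R_le[xi|xi]] := srs_lexx x.
  by right; apply: srs_I_up Ii; rewrite -[i]srs_invK; exact: srs_le_inv.
left; apply: srs_I_up Ii; rewrite -[i]srs_invK -[x]srs_invK; exact: srs_le_inv.
Qed.

Lemma srs_R_inv (x : X) : rs_R x x^* x^*.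
Proof. by apply: srs_contra; apply: srs_le_R; exact: srs_lexx. Qed.

Lemma srs_inv_le (x : X) : I x -> x^* <=r x.
Proof.
by move=> Ix; apply: (srs_I_R Ix); have /srs_RC := srs_R_inv x^*; rewrite srs_invK.
Qed.

Lemma srs_fixed (x : X) : I x -> I x^* -> x = x^*.
Proof.
move=> Ix Ix'; apply: srs_le_anti; last exact: srs_inv_le.
by rewrite -{1}[x]srs_invK; exact: srs_inv_le.
Qed.

(* Associativity applied to [(x x') z], which contains [z], yields [v] with
   [R x v z] and [R z v' x], and one of [v], [v'] lies in [I]. *)
Lemma srs_comparableP (x z : X) : I x -> I z ->
  x^* <=r z <-> comparable_by (@rs_le X) x z.
Proof.
move=> Ix Iz; split=> [x'z|[xz|zx]]; last 2 first.
- by apply: srs_le_trans xz; exact: srs_inv_le.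
- by apply: srs_le_trans (srs_inv_le Iz); exact: srs_le_inv.
have [v Rx'zv Rxvz] := srs_assoc (srs_R_inv x) (srs_le_R x'z (srs_lexx z)).
have [Iv|Iv'] := srs_I_total v.
  by left; exact: srs_I_R Iv (srs_RC Rxvz).
right; apply: srs_I_R Iv' _; apply: srs_RC.
by rewrite -[x]srs_invK; apply: srs_contra; exact: srs_RC.
Qed.

(** The chain x' <= y' <= y <= z reduces this to [srs_comparableP]. *)
Lemma srs_forest (x y z : X) : I y -> y <=r x -> y <=r z ->
  comparable_by (@rs_le X) x z.
Proof.
move=> Iy yx yz; apply/srs_comparableP; [exact: srs_I_up yx Iy|exact: srs_I_up yz Iy|].
apply: srs_le_trans yz; apply: srs_le_trans (srs_inv_le Iy); exact: srs_le_inv.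
Qed.

(** Transitivity suffices unless [b] lies below both others; then these are comparable by
    [srs_forest]. *)
Lemma srs_max3 (a b c : X) : I b ->
  comparable_by (@rs_le X) a b -> comparable_by (@rs_le X) b c ->
  [\/ (b <=r a /\ c <=r a), (a <=r b /\ c <=r b) | (a <=r c /\ b <=r c)].
Proof.
move=> Ib [ab|ba] [bc|cb]; [constructor 3|constructor 2| |constructor 1].
- by split=> //; exact: srs_le_trans ab bc.
- by [].
- by case: (srs_forest Ib ba bc) => h; [constructor 3|constructor 1].
- by split=> //; exact: srs_le_trans cb ba.
Qed.

Lemma srs_I_R_ub (x y z : X) : I x -> I y -> rs_R x y z -> x <=r z /\ y <=r z.
Proof. by move=> Ix Iy R; split; [exact: srs_I_R (srs_RC R)|exact: srs_I_R R]. Qed.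

(** Associativity for R p q' r and R r r' r' yields [v] with R q' r' v and R p v r'. Contraposing
    the latter puts [p] below v', and idempotence in the former puts v' below [q] or [r]. *)
Lemma srs_R_dominated (p q r : X) : I p -> I q -> I r -> rs_R p q^* r ->
  p <=r q \/ p <=r r.
Proof.
move=> Ip Iq Ir R; have [v Rq'r'v Rpvr'] := srs_assoc R (srs_R_inv r).
have [pv rv] : p <=r v^* /\ r <=r v^*.
  by apply: srs_I_R_ub => //; rewrite -{1}[r]srs_invK; exact: srs_contra.
case: (srs_R_le Rq'r'v) => /srs_le_inv; rewrite srs_invK => h; [left|right];
  exact: srs_le_trans h.
Qed.

(** At least one of [x] and x' lies in [I], and if both do they are equal, so this is the one in
    [I]. *)
Definition srs_abs (x : X) : X := if `[< I x >] then x else x^*.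

Lemma srs_absI (x : X) : I x -> srs_abs x = x.
Proof. by rewrite /srs_abs; case: asboolP. Qed.

Lemma srs_absN (x : X) : I x^* -> srs_abs x = x^*.
Proof. by move=> Ix'; rewrite /srs_abs; case: asboolP => // Ix; exact: srs_fixed. Qed.

Lemma srs_I_abs (x : X) : I (srs_abs x).
Proof. by rewrite /srs_abs; case: asboolP => // nIx; case: (srs_I_total x). Qed.

Lemma srs_abs_inv (x : X) : srs_abs x^* = srs_abs x.
Proof.
have [Ix|Ix'] := srs_I_total x; last by rewrite srs_absI// srs_absN.
by rewrite (srs_absI Ix) srs_absN ?srs_invK.
Qed.

Lemma srs_le_abs (x : X) : x <=r srs_abs x.
Proof.
rewrite /srs_abs; case: asboolP => [_|nIx]; first exact: srs_lexx.
have [//|Ix'] := srs_I_total x.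
by rewrite -{1}[x]srs_invK; exact: srs_inv_le.
Qed.

Lemma srs_inv_abs_le (x : X) : (srs_abs x)^* <=r x.
Proof.
rewrite -{2}[x]srs_invK; apply: srs_le_inv.
by rewrite -srs_abs_inv; exact: srs_le_abs.
Qed.

(* [x], being of the form -|x|, dominates the other two elements. *)
Definition srs_dominates (x y z : X) :=
  [/\ I x^*, srs_abs y <=r srs_abs x & srs_abs z <=r srs_abs x].

(** The forward direction splits on which of [x], [y], [z] lie in [I]. Commutativity and
    contraposition permute [x], [y] and z', so apart from inputs both in [I] there remain the mixed
    case [pm] and the case of x', y', [z] in [I]. *)
Lemma srs_RP (x y z : X) : rs_R x y z <->
  [\/ srs_dominates x y z, srs_dominates y x z | srs_dominates z^* x y].
Proof.
have dom (a b c : X) : srs_dominates a b c -> rs_R a b c.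
  move=> [Ia' ba ca]; have Eabs := srs_absN Ia'.
  (* R a a' a weakens to [R a b c], since b <= |b| <= a' and a = |a|' <= |c|' <= c. *)
  apply: (rs_R_mono Xrs (srs_RC (srs_R_inv a^*))).
  - by rewrite srs_invK; exact: srs_lexx.
  - by rewrite -Eabs; exact: srs_le_trans (srs_le_abs b) ba.
  - by apply: srs_le_trans (srs_inv_abs_le c); apply: srs_le_inv; rewrite -Eabs.
split; last first.
  case=> [|/dom/srs_RC|] //; first exact: dom.
  move=> [Iz xz yz]; have {Iz} Iz : I z by rewrite -[z]srs_invK.
  move: xz yz; rewrite srs_abs_inv (srs_absI Iz) => xz yz.
  by apply: srs_le_R;
    [exact: srs_le_trans (srs_le_abs x) xz|exact: srs_le_trans (srs_le_abs y) yz].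
move=> R; rewrite /srs_dominates srs_invK srs_abs_inv.
(* If c' is in [I], contraposition makes b' an upper bound of [a] and c'. Otherwise b' and [c] are
   comparable because b <= c, and [srs_R_dominated] puts [a] below the larger one. *)
have pm (a b c : X) : I a -> I b^* -> rs_R a b c ->
    [\/ srs_dominates a b c, srs_dominates b a c | srs_dominates c^* a b].
  move=> Ia Ib' Rabc; rewrite /srs_dominates srs_invK srs_abs_inv.
  rewrite (srs_absI Ia) (srs_absN Ib').
  have [Ic|Ic'] := srs_I_total c; last first.
    rewrite (srs_absN Ic'); constructor 2.
    have /(srs_I_R_ub Ia Ic')[ab cb] := srs_contra Rabc.
    by split.
  rewrite (srs_absI Ic).
  have Rab'c : rs_R a b^*^* c by rewrite srs_invK.
  have bc : b^*^* <=r c by exact: srs_I_R Rab'c.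
  have [bc'|cb'] := (srs_comparableP Ib' Ic).1 bc.
    constructor 3; split=> //.
    by have [h|//] := srs_R_dominated Ia Ib' Ic Rab'c; exact: srs_le_trans h bc'.
  constructor 2; split=> //.
  by have [//|h] := srs_R_dominated Ia Ib' Ic Rab'c; exact: srs_le_trans h cb'.
have [Ix|Ix'] := srs_I_total x; have [Iy|Iy'] := srs_I_total y.
- have [xz yz] := srs_I_R_ub Ix Iy R.
  have Iz := srs_I_up xz Ix; constructor 3.
  by rewrite (srs_absI Ix) (srs_absI Iy) (srs_absI Iz).
- have := pm _ _ _ Ix Iy' R; by rewrite /srs_dominates srs_invK srs_abs_inv.
- have := pm _ _ _ Iy Ix' (srs_RC R); rewrite /srs_dominates srs_invK srs_abs_inv.
  by case=> [|[]|[]] ?; [constructor 2|constructor 1|constructor 3].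
- have [Iz|Iz'] := srs_I_total z; last first.
    (* The rearrangement R z' x y' falls under the mixed case. *)
    have := pm _ _ _ Iz' Ix' (srs_RC (srs_contra R)).
    rewrite /srs_dominates !srs_invK !srs_abs_inv.
    by case=> [[]|[]|[]]; [constructor 3|constructor 1|constructor 2].
  rewrite (srs_absN Ix') (srs_absN Iy') (srs_absI Iz).
  set p := x^* in Ix' *; set q := y^* in Iy' *.
  have pE : x = p^* by rewrite srs_invK.
  have qE : y = q^* by rewrite srs_invK.
  move: R; rewrite pE qE => R.
  (* Idempotence in three rearrangements of [R] makes each of [z], [q], [p] comparable with one of
     the other two. Hence two of the three pairs are comparable, and [srs_max3] gives a greatest
     element. *)
  have C1 : comparable_by (@rs_le X) p z \/ comparable_by (@rs_le X) q z.
    by case: (srs_R_le R) => h; [left|right]; apply/srs_comparableP.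
  have C2 : comparable_by (@rs_le X) p q \/ comparable_by (@rs_le X) z q.
    have := srs_R_le (srs_contra R); rewrite srs_invK.
    by case=> h; [left|right]; apply/srs_comparableP.
  have C3 : comparable_by (@rs_le X) q p \/ comparable_by (@rs_le X) z p.
    have := srs_R_le (srs_contra (srs_RC R)); rewrite srs_invK.
    by case=> h; [left|right]; apply/srs_comparableP.
  suff : [\/ (q <=r p /\ z <=r p), (p <=r q /\ z <=r q) | (p <=r z /\ q <=r z)].
    by case=> -[]; [constructor 1|constructor 2|constructor 3].
  case: C1 => [pz|qz].
    case: C2 => [pq|zq].
      by have [[]|[]|[]] := srs_max3 Ix' (comparable_by_sym pz) pq;
        [constructor 3|constructor 1|constructor 2].
    by have [[]|[]|[]] := srs_max3 Iz pz zq;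
      [constructor 1|constructor 3|constructor 2].
  case: C3 => [qp|zp].
    by have [[]|[]|[]] := srs_max3 Iy' (comparable_by_sym qp) qz;
      [constructor 1|constructor 2|constructor 3].
  by have [[]|[]|[]] := srs_max3 Iz (comparable_by_sym zp) (comparable_by_sym qz);
    [constructor 1|constructor 3|constructor 2].
Qed.

End sugihara_relevant_space_theory.

(** * The unpointed Sugihara space on [I] *)

Section lower_bowtie.
Context (X : relevant_frame) (XP : sugihara_relevant_space X).
Local Notation I := (rs_I X).
Local Notation LX := (lower_bowtie X).

Let Xrs : relevant_space X. Proof. by case: XP. Qed.
Let cI : clopen I. Proof. by case: (rs_I_clopen_up Xrs). Qed.

Lemma lower_bowtie_I (x : LX) : I (\val x).
Proof. exact: set_typeP. Qed.

Lemma lower_bowtie_clopen_preimage (U : set X) :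
  clopen U -> clopen (\val @^-1` U : set LX).
Proof. by move=> cU; apply: preimage_clopen => //; exact: set_val_continuous. Qed.

Lemma lower_bowtie_priestley : priestley_space (@ss_le LX).
Proof.
have [cX _ sep] := rs_priestley Xrs.
split.
- by apply: set_type_compact => //; case: cI.
- split=> [x|x y xy yx|x y z]; first exact: srs_lexx.
    by apply: val_inj; exact: srs_le_anti.
  exact: srs_le_trans.
- move=> x y /sep[U [[cU uU] Ux nUy]]; exists (\val @^-1` U); split=> //.
  split; first exact: lower_bowtie_clopen_preimage.
  by move=> a b ab; exact: uU.
Qed.

Lemma lower_bowtie_dual_image (U : set LX) :
  clopen_up_set (@ss_le LX) U -> dual_carrier X (\val @` U).
Proof.
move=> [cU uU]; split; first exact: clopen_set_type_image.
move=> x' y x'y [x Ux xE]; have xy : rs_le (\val x) y by rewrite xE.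
have Iy : I y by apply: (srs_I_up XP xy); exact: lower_bowtie_I.
by exists (exist _ y (mem_set Iy)) => //; exact: uU Ux.
Qed.

(* On up-sets contained in [I] the residual [=>] cuts down to the Heyting
   implication of the up-sets of [I]. *)
Lemma lower_bowtie_down_closureE (U V : set LX) : up_set (@ss_le LX) U ->
  down_closure (@ss_le LX) (U `\` V) =
  ~` (\val @^-1` rs_imp (\val @` U) (\val @` V)).
Proof.
move=> uU; apply/seteqP; split=> x.
  move=> [y [Uy nVy] xy] /= H.
  have [|w Vw /val_inj wy] := H (\val y) (\val y) _ (ex_intro2 _ _ y Uy erefl).
    by apply: (srs_le_R XP) => //; exact: srs_lexx.
  by apply: nVy; rewrite -wy.
move=> nH; apply: contrapT => nD; apply: nH => y0 z R [y Uy yE].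
have [xz yz] : rs_le (\val x) z /\ rs_le (\val y) z.
  by apply: (srs_I_R_ub XP); [exact: lower_bowtie_I|exact: lower_bowtie_I|rewrite yE].
have Iz : I z by apply: (srs_I_up XP xz); exact: lower_bowtie_I.
exists (exist _ z (mem_set Iz)) => //; apply: contrapT => nVz.
apply: nD; exists (exist _ z (mem_set Iz)) => //; split=> //.
exact: uU Uy.
Qed.

(** Down-closures of differences of clopen up-sets are complements of traces of residuals, and
    clopen up-sets are closed under residuals. *)
Lemma lower_bowtie_esakia : esakia_space (@ss_le LX).
Proof.
apply: esakia_of_differences; first exact: lower_bowtie_priestley.
move=> U V AU AV; rewrite lower_bowtie_down_closureE; last by case: AU.
have [+ _] := rs_imp_closed Xrs (lower_bowtie_dual_image AU) (lower_bowtie_dual_image AV).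
by move=> /lower_bowtie_clopen_preimage/(clopenC (set0 : set LX))[].
Qed.

Lemma lower_bowtie_unpointed : unpointed_sugihara_space LX.
Proof.
split.
- exact: lower_bowtie_esakia.
(* Within [I], being fixed by the involution amounts to x' lying in [I], which is a clopen
   condition. *)
- have -> : ss_D LX = \val @^-1` (@rs_inv X @^-1` I).
    apply/seteqP; split=> x /=; first by move=> <-; exact: lower_bowtie_I.
    by move=> Ix'; apply: srs_fixed => //; exact: lower_bowtie_I.
  apply: lower_bowtie_clopen_preimage; apply: preimage_clopen => //.
  exact: rs_inv_continuous.
- by move=> x; left; exact: srs_lexx.
(* If y <= x and x = x', then x = x' <= y' <= y. *)
- move=> x y [//|yx] /= Dx; rewrite Dx.
  apply: srs_le_trans (srs_inv_le XP (lower_bowtie_I y)) => //.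
  exact: srs_le_inv.
- move=> x y z [xy|yx] yz; first by right; exact: srs_le_trans xy yz.
  by apply: (srs_forest XP (lower_bowtie_I y)).
Qed.

End lower_bowtie.

(** For the back condition, f x <= z gives R (f x) z z, which lifts to [R x u v] with z <= f u and f
    v <= z. As [x] is in [I], u <= v, so both images equal [z], and [v] is the required point above
    [x]. *)
Lemma lower_bowtie_map_morphism (X Y : SRS) (f : hom X Y) :
  sugihara_space_map (lower_bowtie_map f).
Proof.
have XP := srs_strP X; have YP := srs_strP Y; have fP := srs_funP f.
have fI (x : X) : rs_I Y (srs_fun f x) = rs_I X x by rewrite -(rm_I fP).
split.
- apply/continuousP => _ [W oW <-].
  rewrite (_ : _ @^-1` _ = \val @^-1` (srs_fun f @^-1` W)) //.
  apply: open_comp => [x _|]; first exact: set_val_continuous.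
  by apply: open_comp => // x _; exact: (rm_continuous fP).
- by move=> x y; exact: (rm_isotone fP).
- move=> x z xz.
  have [u [v [Rxuv zu vz]]] : exists u v, [/\ rs_R (\val x) u v,
      rs_le (\val z) (srs_fun f u) & rs_le (srs_fun f v) (\val z)].
    by apply: (rm_back_imp fP); apply: (srs_le_R YP) => //; exact: srs_lexx.
  have uv : rs_le u v by exact: (srs_I_R XP (lower_bowtie_I x)).
  have fuz : srs_fun f u = \val z.
    apply: (srs_le_anti YP) => //.
    by apply: (srs_le_trans YP) vz; exact: (rm_isotone fP).
  have Iu : rs_I X u by rewrite -fI fuz; exact: lower_bowtie_I.
  have [xv _] := srs_I_R_ub XP (lower_bowtie_I x) Iu Rxuv.
  have fvz : srs_fun f v = \val z.
    apply: (srs_le_anti YP) => //.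
    by apply: (srs_le_trans YP) zu _; exact: (rm_isotone fP).
  have Iv : rs_I X v by exact: (srs_I_up XP uv).
  by exists (exist _ v (mem_set Iv)) => //; exact: val_inj.
- by move=> x /= Dx; rewrite -(rm_inv fP) -Dx.
- move=> x nDx /= Dfx; apply: nDx; apply: (srs_fixed XP) => /=.
    exact: lower_bowtie_I.
  by rewrite -fI (rm_inv fP) -Dfx fI; exact: lower_bowtie_I.
Qed.

(** * The structure of X^bowtie *)

Section sugihara_space_theory.
Context (X : sugihara_frame) (XP : unpointed_sugihara_space X).

Lemma ss_lexx (x : X) : ss_le x x.
Proof. by have [[[_ [+ _ _] _] _] _ _ _ _] := XP; apply. Qed.

Lemma ss_le_anti (x y : X) : ss_le x y -> ss_le y x -> x = y.
Proof. by have [[[_ [_ + _] _] _] _ _ _ _] := XP; apply. Qed.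

Lemma ss_le_trans (y x z : X) : ss_le x y -> ss_le y z -> ss_le x z.
Proof. by have [[[_ [_ _ +] _] _] _ _ _ _] := XP; apply. Qed.

Lemma ss_forest (x y z : X) : ss_le y x -> ss_le y z -> comparable_by ss_le x z.
Proof.
by have [_ _ _ _ F] := XP => yx yz; apply/comparable_by_sym/(F _ y) => //; right.
Qed.

Lemma ss_D_minimal (x y : X) : ss_D X x -> ss_le y x -> y = x.
Proof.
have [_ _ _ DQ _] := XP.
by move=> Dx yx; apply: ss_le_anti => //; apply: DQ => //; right.
Qed.

Lemma ss_clopen_D : clopen (ss_D X).
Proof. by have [_ + _ _ _] := XP. Qed.

Lemma ss_priestley : priestley_space (@ss_le X).
Proof. by have [[]] := XP. Qed.

Lemma ss_down_clopen (U : set X) : clopen U -> clopen (down_closure ss_le U).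
Proof. by have [[_ +] _ _ _ _] := XP; apply. Qed.

(* The common upper bounds of [x] and [y] form a closed chain. *)
Lemma ss_join_exists (x y c : X) : ss_le x c -> ss_le y c ->
  exists j, is_join ss_le x y j.
Proof.
move=> xc yc; have [cX _ _] := ss_priestley.
(* A point common to all [S w] is a common upper bound lying below every common upper bound [w]. *)
pose S w := [set z : X | [/\ ss_le x z, ss_le y z & ss_le z w]].
have [j Hj] : exists j, forall P,
    [set S w | w in [set w | ss_le x w /\ ss_le y w]] P -> P j.
  apply: compact_directed_cap => //.
  - by exists (S c), c.
  - move=> _ [w [xw yw] <-]; split; last by exists w; split=> //; exact: ss_lexx.
    have -> : S w = [set z | ss_le x z] `&` [set z | ss_le y z] `&` [set z | ss_le z w].
      by apply/seteqP; split=> z [] //= [].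
    apply: closedI; last exact: (priestley_closed_down ss_priestley).
    by apply: closedI; exact: (priestley_closed_up ss_priestley).
  - move=> _ _ [w [xw yw] <-] [w' [xw' yw'] <-].
    case: (ss_forest xw xw') => h; [exists (S w)|exists (S w')]; try by exists w.
    + by move=> z [? ? zw]; split; split=> //; exact: ss_le_trans h.
    + by exists w'.
    + by move=> z [? ? zw]; split; split=> //; exact: ss_le_trans h.
have jS w : ss_le x w -> ss_le y w -> S w j by move=> ? ?; apply: Hj; exists w.
exists j; have [? ? _] := jS c xc yc.
by split=> // z xz yz; case: (jS z xz yz).
Qed.

End sugihara_space_theory.

(** * Order and ternary relation of X^bowtie *)

Section bowtie_order.
Context (X : sugihara_frame) (XP : unpointed_sugihara_space X).
Implicit Types u v w z : bowtie X.

Local Notation "u <=b v" := (bowtie_le u v) (at level 70).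
Local Notation "`| u |" := (bowtie_abs u).

(* Membership in the copy -X of [X], which meets [X] in [D]. *)
Definition bowtie_negative (u : bowtie X) : Prop :=
  match u with inl x => ss_D X x | inr _ => True end.

Lemma bowtie_abs_neg u : `|bowtie_neg u| = `|u|.
Proof.
case: u => [x|//]; have [Dx|nDx] := pselect (ss_D X x); first by rewrite bowtie_neg_D.
by rewrite (bowtie_neg_DC (mem_set nDx)).
Qed.

Lemma bowtie_neg_negative u : bowtie_negative (bowtie_neg u) = bowtie_base u.
Proof.
apply/propext; case: u => [x|x].
  split=> [_|_]; first by exists x.
  have [Dx|nDx] := pselect (ss_D X x); first by rewrite bowtie_neg_D.
  by rewrite (bowtie_neg_DC (mem_set nDx)).
by split=> [/= Dx|[]//]; case: (set_typeP x).
Qed.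

Lemma bowtie_base_neg u : bowtie_base (bowtie_neg u) = bowtie_negative u.
Proof. by rewrite -bowtie_neg_negative bowtie_negK. Qed.

Lemma bowtie_negativeP u : bowtie_negative u <-> u = bowtie_neg (inl `|u|).
Proof.
split=> [|->]; last by rewrite bowtie_neg_negative; exists `|u|.
by rewrite -bowtie_base_neg => -[x _ xE]; rewrite -[u]bowtie_negK -xE bowtie_abs_neg.
Qed.

Lemma bowtie_base_abs u : bowtie_base u -> u = inl `|u|.
Proof. by case=> x _ <-. Qed.

Lemma bowtie_base_negative u : bowtie_base u -> bowtie_negative u -> ss_D X `|u|.
Proof. by case=> x _ <-. Qed.

Lemma bowtie_D_negative u : ss_D X `|u| -> bowtie_negative u.
Proof. by case: u. Qed.

(** This form treats [X] and -X alike, so negation just exchanges the disjuncts. Points of [D],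
    which lie in both, cause no conflict because they are minimal in [X]. *)
Lemma bowtie_leP u v : u <=b v <->
  (bowtie_base v /\ ss_le `|u| `|v|) \/ (bowtie_negative u /\ ss_le `|v| `|u|).
Proof.
have nb (x : set_type (~` ss_D X)) : ~ bowtie_base (inr x : bowtie X) by case.
case: u v => [x|x] [y|y] /=; split=> //.
- by move=> xy; left; split=> //; exists y.
- by case=> -[] // Dx yx; rewrite (ss_D_minimal XP Dx yx); exact: ss_lexx.
- case=> -[]; first by move=> /nb.
  move=> Dx /(ss_D_minimal XP Dx) yx.
  by have : (~` ss_D X) (sval y) := set_typeP y; rewrite yx.
- by case=> h; [left|right]; split=> //; exists y.
- by case=> -[_ h]; [left|right].
- by right.
- by case=> -[] // /nb.
Qed.

Lemma bowtie_comparableP u v :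
  comparable_by (@bowtie_le X) u v <-> comparable_by ss_le `|u| `|v|.
Proof.
have bn w : bowtie_base w \/ bowtie_negative w.
  by case: w => [x|x]; [left; exists x|right].
split.
  by case=> /bowtie_leP[] [_ h]; by [left|right].
case=> h.
  by case: (bn v) => bv; [left|right]; apply/bowtie_leP; [left|right].
by case: (bn u) => bv; [right|left]; apply/bowtie_leP; [left|right].
Qed.

(** In the mixed cases of transitivity the middle element either lies in [D], so minimality makes
    all absolute values equal, or has absolute value below both others, which are then comparable by
    the forest property. *)
Lemma bowtie_le_order : partial_order (@bowtie_le X).
Proof.
split.
- by case=> x /=; exact: ss_lexx.
- case=> [x|x] [y|y] //= xy yx; first by rewrite (ss_le_anti XP xy yx).
  by rewrite (val_inj (ss_le_anti XP yx xy)).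
- move=> u v w /bowtie_leP[[bv uv]|[nu vu]] /bowtie_leP[[bw vw]|[nv wv]].
  + by apply/bowtie_leP; left; split=> //; exact: (ss_le_trans XP) vw.
  + have Dv := bowtie_base_negative bv nv.
    apply/bowtie_leP; right; rewrite (ss_D_minimal XP Dv wv) (ss_D_minimal XP Dv uv).
    split; last exact: ss_lexx.
    by apply: bowtie_D_negative; rewrite (ss_D_minimal XP Dv uv).
  + by case: (ss_forest XP vu vw) => h; apply/bowtie_leP; [left|right].
  + by apply/bowtie_leP; right; split=> //; exact: (ss_le_trans XP) vu.
Qed.

Lemma bowtie_neg_antitone u v : u <=b v -> bowtie_neg v <=b bowtie_neg u.
Proof.
move=> /bowtie_leP uv; apply/bowtie_leP.
rewrite bowtie_base_neg bowtie_neg_negative !bowtie_abs_neg; tauto.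
Qed.

Definition bowtie_dominates (u v w : bowtie X) :=
  [/\ bowtie_negative u, ss_le `|v| `|u| & ss_le `|w| `|u|].

(* A symmetric form of the relation [R]: see [bowtie_RP]. *)
Definition bowtie_triangle (u v w : bowtie X) :=
  [\/ bowtie_dominates u v w, bowtie_dominates v u w | bowtie_dominates w u v].

Lemma bowtie_triangleC u v w : bowtie_triangle u v w -> bowtie_triangle v u w.
Proof. by case=> -[]; [constructor 2|constructor 1|constructor 3]. Qed.

Lemma bowtie_triangleCr u v w : bowtie_triangle u v w -> bowtie_triangle u w v.
Proof. by case=> -[]; [constructor 1|constructor 3|constructor 2]. Qed.

(** The critical case is [w'] in -X with |w| <= |w'| while some [a] dominates: |a| and |w'| both lie
    above |w|, hence are comparable, and the larger one dominates. *)
Lemma bowtie_triangle_mono u v w w' :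
  bowtie_triangle u v w -> w' <=b w -> bowtie_triangle u v w'.
Proof.
have lt := ss_le_trans XP.
have main a b : bowtie_negative a -> ss_le `|b| `|a| -> ss_le `|w| `|a| ->
    w' <=b w -> bowtie_dominates a b w' \/ bowtie_dominates w' a b.
  move=> na ba wa /bowtie_leP[[_ h]|[nw' h]].
    by left; split=> //; exact: lt h wa.
  case: (ss_forest XP wa h) => aw'; last by left.
  by right; split=> //; exact: lt ba aw'.
case=> -[n h1 h2] w'w.
- by case: (main u v n h1 h2 w'w); [constructor 1|constructor 3].
- case: (main v u n h1 h2 w'w); first by constructor 2.
  by case=> *; constructor 3.
- move: w'w => /bowtie_leP[[bw w'w]|[nw' ww']].
    have Dw := bowtie_base_negative bw n.
    constructor 3; rewrite /bowtie_dominates (ss_D_minimal XP Dw w'w); split=> //.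
    by apply: bowtie_D_negative; rewrite (ss_D_minimal XP Dw w'w).
  by constructor 3; split=> //; [exact: lt h1 ww'|exact: lt h2 ww'].
Qed.

(** Serves the join clause of the partial product. *)
Lemma bowtie_ub_triangle u v z : u <=b z -> v <=b z ->
  bowtie_triangle u v (bowtie_neg z).
Proof.
rewrite /bowtie_triangle /bowtie_dominates bowtie_abs_neg bowtie_neg_negative.
move=> /bowtie_leP[[bz uz]|[nu zu]] /bowtie_leP[[_ vz]|[nv zv]].
- by constructor 3.
- by constructor 2; split=> //; exact: (ss_le_trans XP) zv.
- by constructor 1; split=> //; exact: (ss_le_trans XP) zu.
- by case: (ss_forest XP zu zv) => h; [constructor 2|constructor 1].
Qed.

(** Serves the other clauses of the partial product, whose value is the argument of larger absolute
    value or a meet of arguments with equal absolute values. *)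
Lemma bowtie_abs_triangle u v z : ss_le `|u| `|v| -> v <=b z ->
  bowtie_triangle u v (bowtie_neg z).
Proof.
rewrite /bowtie_triangle /bowtie_dominates bowtie_abs_neg bowtie_neg_negative.
move=> uv /bowtie_leP[[bz vz]|[nv zv]]; last by constructor 2.
by constructor 3; split=> //; exact: (ss_le_trans XP) vz.
Qed.

(** The product is [u], by the meet clause for equal absolute values and by the strict clause
    otherwise. *)
Lemma bowtie_dominates_R u v z : bowtie_dominates u v z -> bowtie_R u v z.
Proof.
move=> [nu vu zu]; exists u; last by apply/bowtie_leP; right.
have uv : u <=b v by apply/bowtie_leP; right.
have [E|NE] := pselect (`|v| = `|u|).
  constructor 4; split=> //; first by left.
  by have [rf _ _] := bowtie_le_order; split=> //; exact: rf.
by constructor 3; split=> //; left.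
Qed.

Lemma bowtie_RC u v z : bowtie_R u v z -> bowtie_R v u z.
Proof.
move=> [w uvw wz]; exists w => //; have sym := @comparable_by_sym _ (@bowtie_le X).
case: uvw => [[c [? ? jP]]|[c ? ->]|[c ? ->]|[c e [? ? mP]]].
- constructor 1; split; last by split=> // t ? ?; apply: jP.
  by case: c => [[]|nc]; [left|right => /sym].
- by constructor 3; split=> //; exact: sym.
- by constructor 2; split=> //; exact: sym.
- by constructor 4; split=> //; [exact: sym|split=> // t ? ?; apply: mP].
Qed.

Lemma bowtie_RP u v z : bowtie_R u v z <-> bowtie_triangle u v (bowtie_neg z).
Proof.
have [rf _ tr] := bowtie_le_order.
split.
  move=> [w + wz]; case=> [[_ [uw vw _]]|[_ [uv _] wE]|[_ [vu _] wE]|[c E [wu wv m]]].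
  - by apply: bowtie_ub_triangle; exact: tr wz.
  - by apply: bowtie_abs_triangle => //; rewrite -wE.
  - by apply/bowtie_triangleC/bowtie_abs_triangle => //; rewrite -wE.
  - case: c => h.
      apply/bowtie_triangleC/bowtie_abs_triangle; first by rewrite E; exact: ss_lexx.
      by apply: tr wz; exact: m.
    apply/bowtie_abs_triangle; first by rewrite E; exact: ss_lexx.
    by apply: tr wz; exact: m.
case=> [|d|].
- rewrite /bowtie_dominates bowtie_abs_neg; exact: bowtie_dominates_R.
- apply/bowtie_RC/bowtie_dominates_R.
  by move: d; rewrite /bowtie_dominates bowtie_abs_neg.
rewrite /bowtie_dominates bowtie_abs_neg bowtie_neg_negative => -[bz uz vz].
have {}uz' : u <=b z by apply/bowtie_leP; left.
have {}vz' : v <=b z by apply/bowtie_leP; left.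
have [c|nc] := pselect (comparable_by (@bowtie_le X) u v).
  have [E|NE] := pselect (`|u| = `|v|).
    by case: (c) => h; [exists u|exists v] => //;
      constructor 4; split=> //; split=> //; exact: rf.
  case: (bowtie_comparableP u v).1 => // h; [exists v|exists u] => //.
    by constructor 2.
  by constructor 3; split=> //; split=> // /esym.
(* The join of |u| and |v| in [X] is also the join of [u] and [v]: an upper bound not above both
   through the [X] clause would make |u| and |v| comparable. *)
have [j [uj vj jP]] := ss_join_exists XP uz vz.
exists (inl j); last by rewrite (bowtie_base_abs bz); exact: jP.
constructor 1; split; first by right.
have nc' : ~ comparable_by ss_le `|u| `|v| by rewrite -bowtie_comparableP.
split; [by apply/bowtie_leP; left; split=> //; exists j..|].
move=> w /bowtie_leP[[bw uw]|[nu wu]] /bowtie_leP[[_ vw]|[nv wv]].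
- by rewrite (bowtie_base_abs bw); exact: jP.
- by case: nc'; left; exact: (ss_le_trans XP) wv.
- by case: nc'; right; exact: (ss_le_trans XP) wu.
- by case: nc'; exact: (ss_forest XP wu wv).
Qed.

End bowtie_order.

(** * X^bowtie as a Sugihara relevant space *)

Section bowtie_topology.
Context (X : sugihara_frame) (XP : unpointed_sugihara_space X).
Implicit Types u v w z : bowtie X.

Local Notation "u <=b v" := (bowtie_le u v) (at level 70).
Local Notation "`| u |" := (bowtie_abs u).
Local Notation A := (clopen_up_set (@bowtie_le X)).

Lemma bowtie_inl_continuous : continuous (inl : X -> bowtie X).
Proof. by apply/continuousP => U []. Qed.

Lemma bowtie_inr_continuous : continuous (inr : set_type (~` ss_D X) -> bowtie X).
Proof. by apply/continuousP => U []. Qed.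

Lemma bowtie_abs_continuous : continuous (@bowtie_abs X : bowtie X -> X).
Proof.
apply/continuousP => W oW; split=> //.
by apply/set_type_open; exists W.
Qed.

(** On [X], negation is glued from the identity on [D] and the passage to the copy off [D]; both
    pieces are open. *)
Lemma bowtie_neg_continuous : continuous (@bowtie_neg X : bowtie X -> bowtie X).
Proof.
have [oD clD] := ss_clopen_D XP.
apply/continuousP => U [oU oU']; split; last first.
  by apply/set_type_open; exists ((inl : X -> bowtie X) @^-1` U).
rewrite (_ : _ @^-1` _ = (ss_D X `&` (inl : X -> bowtie X) @^-1` U) `|`
    \val @` ((inr : set_type (~` ss_D X) -> bowtie X) @^-1` U)).
  apply: openU; first exact: openI.
  by apply: open_set_type_image => //; exact: closed_openC.
apply/seteqP; split=> x.
  have [Dx|nDx] := pselect (ss_D X x); rewrite /preimage /mkset.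
    by rewrite bowtie_neg_D//; left.
  rewrite (bowtie_neg_DC (mem_set nDx)) => Ux; right.
  by exists (exist _ x (mem_set nDx)).
case=> [[Dx Ux]|[y Uy <-]]; rewrite /preimage /mkset; first by rewrite bowtie_neg_D.
by rewrite /bowtie_neg valK.
Qed.

Lemma bowtie_compact : compact [set: bowtie X].
Proof.
have [cX _ _] := ss_priestley XP; have [oD clD] := ss_clopen_D XP.
have -> : [set: bowtie X] = inl @` setT `|` inr @` setT.
  by apply/seteqP; split=> // -[x|x] _; [left|right]; exists x.
suff [c1 c2] : compact (inl @` setT : set (bowtie X)) /\
    compact (inr @` setT : set (bowtie X)).
  exact: compactU.
split.
  apply: (@continuous_compact X (bowtie X) inl) => //.
  by apply: continuous_subspaceT; exact: bowtie_inl_continuous.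
apply: (@continuous_compact (set_type (~` ss_D X)) (bowtie X) inr).
  by apply: continuous_subspaceT; exact: bowtie_inr_continuous.
by apply: set_type_compact => //; exact: open_closedC.
Qed.

Lemma bowtie_base_clopen : clopen (@bowtie_base X : set (bowtie X)).
Proof.
split.
  split.
    rewrite (_ : _ @^-1` _ = setT); first exact: openT.
    by apply/seteqP; split=> // x _; exists x.
  by rewrite (_ : _ @^-1` _ = set0); [exact: open0|apply/seteqP; split=> // x []].
rewrite -openC; split.
  rewrite (_ : _ @^-1` _ = set0); first exact: open0.
  by apply/seteqP; split=> // x; case; exists x.
by rewrite (_ : _ @^-1` _ = setT); [exact: openT|apply/seteqP; split=> // x _ []].
Qed.

Lemma bowtie_abs_clopen (K : set X) : clopen K -> clopen [set u | K `|u|].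
Proof. by move=> cK; apply: (preimage_clopen cK); exact: bowtie_abs_continuous. Qed.

Lemma bowtie_base_up : up_set (@bowtie_le X) (@bowtie_base X).
Proof. by move=> [x|x] [y|y] // _; [exists y|case|case]. Qed.

Lemma bowtie_priestley : priestley_space (@bowtie_le X : upper_bowtie X -> _).
Proof.
have [_ _ sep] := ss_priestley XP; have F := ss_forest XP.
have cb := bowtie_base_clopen; have cabs := bowtie_abs_clopen.
split; [exact: bowtie_compact|exact: bowtie_le_order|].
case=> [x|x] [y|y].
- move=> /sep[U [[cU uU] Ux nUy]].
  exists (@bowtie_base X `&` [set u | U `|u|]); split; last by case.
    split; first by apply: clopenI => //; exact: cabs.
    by move=> [a|a] [b|b] //= ab [[]// ? _ _ Ua]; split; [exists b|exact: uU Ua].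
  by split=> //; exists x.
- move=> _; exists (@bowtie_base X).
  by split=> //; [split=> //; exact: bowtie_base_up|exists x|case].
- move=> nxy; have {}nxy : ~ comparable_by ss_le (\val x) y by [].
  have [B [[cB uB] Bx nBy]] : exists B, [/\ clopen_up_set ss_le B, B (\val x) & ~ B y].
    by apply: sep => h; apply: nxy; left.
  have [C [[cC uC] Cy nCx]] : exists C, [/\ clopen_up_set ss_le C, C y & ~ C (\val x)].
    by apply: sep => h; apply: nxy; right.
  (* [K] contains |-x| and omits [y], as [C] is an up-set. By the forest property a point above a
     member of [K] lies in [K] or in [B], so the set given below is an up-set. The Esakia condition
     makes [K] clopen. *)
  pose K := down_closure ss_le (B `\` C).
  have cK : clopen K by apply: ss_down_clopen => //; exact: clopen_setD.
  have dK a b : ss_le a b -> K b -> K a.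
    by move=> ab [k Bk bk]; exists k => //; exact: (ss_le_trans XP) bk.
  have KB a b : ss_le a b -> K a -> K b \/ B b.
    move=> ab [k Bk ak]; case: (F _ _ _ ab ak) => h; first by left; exists k.
    by right; apply: (uB _ _ h); case: Bk.
  exists ([set u | K `|u|] `|` (@bowtie_base X `&` [set u | B `|u|])); split.
  + split; first by apply: clopenU; [|apply: clopenI => //]; exact: cabs.
    move=> [a|a] [b|b] //= ab [Ka|[[z _ zE] Ba]] //=.
    * by case: (KB _ _ ab Ka) => h; [left|right; split=> //; exists b].
    * by right; split; [exists b|exact: uB Ba].
    * case: ab => ab; last by left; exact: dK Ka.
      by case: (KB _ _ ab Ka) => h; [left|right; split=> //; exists b].
    * by left; exact: dK Ka.
  + by left; exists (\val x); [split|exact: ss_lexx].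
  + case=> [[k [Bk nCk] yk]|[_ //]].
    by apply: nCk; exact: uC Cy.
- move=> /sep[B [[cB uB] By nBx]].
  exists (@bowtie_base X `|` ~` [set u | B `|u|]); split.
  + split; first by apply: clopenU => //; apply: clopenC (cabs _ cB); exact: set0.
    move=> [a|a] [b|b] //= ab [[z _ zE]|nBa] //=; try by left; exists b.
    by right=> /= Bb; apply: nBa; exact: uB Bb.
  + by right.
  + by case=> [[]//|]; apply.
Qed.

(** Monotonicity of the triangle in its last place is moved to the others by symmetry. *)
Lemma bowtie_R_mono (x1 x2 y1 y2 z1 z2 : bowtie X) : bowtie_R x1 y1 z1 ->
  x2 <=b x1 -> y2 <=b y1 -> z1 <=b z2 -> bowtie_R x2 y2 z2.
Proof.
move=> /(bowtie_RP XP) R xx yy zz; apply/(bowtie_RP XP).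
apply: (bowtie_triangle_mono XP) (bowtie_neg_antitone XP zz).
apply/bowtie_triangleCr; apply: (bowtie_triangle_mono XP) yy; apply/bowtie_triangleCr.
apply/bowtie_triangleC/bowtie_triangleCr; apply: (bowtie_triangle_mono XP) xx.
exact/bowtie_triangleCr/bowtie_triangleC.
Qed.

Lemma bowtie_R_diag z : bowtie_R z z z.
Proof.
by have [rf _ _] := bowtie_le_order XP; apply/(bowtie_RP XP)/bowtie_ub_triangle.
Qed.

Local Notation pos U := [set x : X | U (inl x : bowtie X)].
Local Notation neg U := [set x : X | U (bowtie_neg (inl x : bowtie X))].

Lemma bowtie_R_inl_neg (y : X) z : ss_le `|z| y ->
  bowtie_R (inl y) (bowtie_neg (inl y)) z.
Proof.
move=> zy; apply/(bowtie_RP XP); constructor 2.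
rewrite /bowtie_dominates !bowtie_abs_neg bowtie_neg_negative; split=> //.
  by exists y.
exact: ss_lexx.
Qed.

(** If [v] is -|v| and dominates, then u <= |v| puts |v| in [U], and symmetrically for [u]; if -z
    dominates, [z] is above both factors. Conversely the pairs y, -y and z, z suffice. *)
Lemma bowtie_mulE (U V : set (bowtie X)) :
  up_set (@bowtie_le X) U -> up_set (@bowtie_le X) V ->
  @rs_mul (upper_bowtie X) U V =
  [set z | down_closure ss_le (pos U `&` neg V) `|z| \/
           down_closure ss_le (pos V `&` neg U) `|z|] `|` (U `&` V).
Proof.
move=> uU uV.
have toP (W : set (bowtie X)) u (y : X) : up_set (@bowtie_le X) W ->
    W u -> ss_le `|u| y -> W (inl y).
  move=> uW Wu uy; apply: uW Wu; apply/(bowtie_leP XP); left; split=> //.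
  by exists y.
apply/seteqP; split=> z.
  move=> [u [v [Uu Vv /(bowtie_RP XP)[]]]]; rewrite /bowtie_dominates bowtie_abs_neg.
  + move=> [/bowtie_negativeP nu vu zu]; left; right; exists `|u| => //.
    by split; [exact: (toP V v)|rewrite /mkset -nu].
  + move=> [/bowtie_negativeP nv uv zv]; left; left; exists `|v| => //.
    by split; [exact: (toP U u)|rewrite /mkset -nv].
  + rewrite bowtie_neg_negative => -[bz uz vz]; right.
    by rewrite (bowtie_base_abs bz); split; [exact: (toP U u)|exact: (toP V v)].
move=> [[[y [Uy Vy] zy]|[y [Vy Uy] zy]]|[Uz Vz]].
- by exists (inl y), (bowtie_neg (inl y)); split=> //; exact: bowtie_R_inl_neg.
- exists (bowtie_neg (inl y)), (inl y); split=> //.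
  by apply: bowtie_RC; exact: bowtie_R_inl_neg.
- by exists z, z; split=> //; exact: bowtie_R_diag.
Qed.

Lemma bowtie_pos_clopen (U : set (bowtie X)) : clopen U -> clopen (pos U).
Proof. by move=> cU; apply: (preimage_clopen cU); exact: bowtie_inl_continuous. Qed.

Lemma bowtie_neg_clopen (U : set (bowtie X)) :
  clopen U -> clopen [set u | U (bowtie_neg u)].
Proof. by move=> cU; apply: (preimage_clopen cU); exact: bowtie_neg_continuous. Qed.

Lemma bowtie_pos_neg_clopen (U V : set (bowtie X)) :
  clopen U -> clopen V -> clopen (pos U `&` neg V).
Proof.
move=> cU cV; apply: clopenI; first exact: bowtie_pos_clopen.
exact: (bowtie_pos_clopen (bowtie_neg_clopen cV)).
Qed.

Lemma bowtie_mul_closed (U V : set (upper_bowtie X)) :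
  dual_carrier (upper_bowtie X) U -> dual_carrier (upper_bowtie X) V ->
  dual_carrier (upper_bowtie X) (rs_mul U V).
Proof.
have [rf _ _] := bowtie_le_order XP.
move=> [cU uU] [cV uV]; split; last first.
  move=> z w zw [u [v [Uu Vv Ruvz]]]; exists u, v; split=> //.
  exact: bowtie_R_mono Ruvz (rf _) (rf _) zw.
rewrite bowtie_mulE//; apply: clopenU; last exact: clopenI.
pose K := down_closure ss_le (pos U `&` neg V) `|` down_closure ss_le (pos V `&` neg U).
apply: (bowtie_abs_clopen (K := K)).
by apply: clopenU; apply: ss_down_clopen => //; exact: bowtie_pos_neg_clopen.
Qed.

(** Associativity goes through [dom4]: a composite of two triangles forces one of [x], [y], [z], -w
    to dominate the other three, and this in turn gives the other bracketing. *)
Lemma bowtie_urquhart : urquhart_conditions (upper_bowtie X).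
Proof.
have lt := ss_le_trans XP.
have half x y z u w : bowtie_R x y u -> bowtie_R u z w ->
    exists2 v, bowtie_R y z v & bowtie_R x v w.
  pose dom4 (a b c d : bowtie X) :=
    [/\ bowtie_negative a, ss_le `|b| `|a|, ss_le `|c| `|a| & ss_le `|d| `|a|].
  move=> /(bowtie_RP XP) T1 /(bowtie_RP XP) T2.
  have : [\/ dom4 x y z w, dom4 y x z w, dom4 z x y w | dom4 (bowtie_neg w) x y z].
    move: T1 T2; rewrite /bowtie_triangle /dom4 /bowtie_dominates !bowtie_abs_neg.
    (* Eliminates [u]: the absolute values of the elements dominating the two triangles both lie
       above |u|, so they are comparable. *)
    have two a b : bowtie_negative a -> ss_le `|b| `|a| -> ss_le `|u| `|a| ->
       [\/ [/\ bowtie_negative u, ss_le `|z| `|u| & ss_le `|w| `|u|],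
       [/\ bowtie_negative z, ss_le `|u| `|z| & ss_le `|w| `|z|]
     | [/\ bowtie_negative (bowtie_neg w), ss_le `|u| `|w| & ss_le `|z| `|w|]] ->
       [\/ dom4 a b z w, dom4 z a b w | dom4 (bowtie_neg w) a b z].
      rewrite /dom4 bowtie_abs_neg => na ba ua [[nu zu wu]|[nz uz wz]|[nw uw zw]].
      - by constructor 1; split=> //; [exact: lt zu ua|exact: lt wu ua].
      - case: (ss_forest XP ua uz) => h; last by constructor 1; split=> //; exact: lt wz h.
        by constructor 2; split=> //; exact: lt ba h.
      - case: (ss_forest XP ua uw) => h; last by constructor 1; split=> //; exact: lt zw h.
        by constructor 3; split=> //; exact: lt ba h.
    case=> [[nx yx ux]|[ny xy uy]|[nu xu yu]].
    - move=> /(two x y nx yx ux); rewrite /dom4 bowtie_abs_neg.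
      by case=> h; [constructor 1|constructor 3|constructor 4].
    - move=> /(two y x ny xy uy); rewrite /dom4 bowtie_abs_neg.
      by case=> -[*]; [constructor 2|constructor 3|constructor 4].
    - case=> [[nu' zu wu]|[nz uz wz]|[nw uw zw]].
      (* Both [u] and its negation dominate, so |u| is in [D] and, by minimality, equals |x|. *)
      + have Du : ss_D X `|u|.
          by apply: bowtie_base_negative => //; rewrite -bowtie_neg_negative.
        have xE := ss_D_minimal XP Du xu.
        constructor 1; rewrite xE; split=> //.
        by apply: bowtie_D_negative; rewrite xE.
      + by constructor 3; split=> //; [exact: lt xu uz|exact: lt yu uz].
      + by constructor 4; split=> //; [exact: lt xu uw|exact: lt yu uw].
  rewrite /dom4 bowtie_abs_neg.
  (* The middle element is the dominating one of [y] and [z], or the negation of the dominating one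
     of [x] and -w. *)
  case=> -[n h1 h2 h3]; [exists (bowtie_neg x)|exists y|exists z|exists w];
    apply/(bowtie_RP XP);
    rewrite /bowtie_triangle /bowtie_dominates ?bowtie_negK ?bowtie_abs_neg;
    have rf := ss_lexx XP; by [constructor 1|constructor 2|constructor 3].
have [rf _ _] := bowtie_le_order XP.
split.
- by move=> x y z; split; exact: bowtie_RC.
- move=> x y z; apply/seteqP; split=> w.
    move=> [u [_ [/= Rxyu -> Ruzw]]].
    by have [v ? ?] := half _ _ _ _ _ Rxyu Ruzw; exists x, v.
  move=> [_ [v [/= -> /bowtie_RC Rzyv /bowtie_RC Rvxw]]].
  have [u Ryxu Rzuw] := half _ _ _ _ _ Rzyv Rvxw.
  by exists u, z; split=> //; exact: bowtie_RC.
- move=> U uU; rewrite bowtie_mulE// setIid; apply/setUidPr => z.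
  have main y : U (bowtie_neg (inl y)) -> ss_le `|z| y -> U z.
    move=> Uy zy; apply: uU Uy; apply/(bowtie_leP XP); right.
    by rewrite bowtie_neg_negative bowtie_abs_neg; split=> //; exists y.
  by case=> -[y [_ Uy]]; exact: main.
- exact: bowtie_negK.
- move=> x y z /(bowtie_RP XP) T; apply/(bowtie_RP XP); rewrite bowtie_negK.
  exact: bowtie_triangleCr.
Qed.

Lemma bowtie_neg_closed (U : set (upper_bowtie X)) :
  dual_carrier (upper_bowtie X) U -> dual_carrier (upper_bowtie X) (rs_neg U).
Proof.
move=> [cU uU]; split; last first.
  by move=> x y xy nUx Uy; apply/nUx/(uU _ _ _ Uy); exact: bowtie_neg_antitone.
rewrite (_ : rs_neg U = ~` [set u | U (bowtie_neg u)])//.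
by apply: clopenC => //; exact: bowtie_neg_clopen.
Qed.

(** By contraposition the residual of [U] and [V] is the negation of the product of [U] with the
    negation of [V]. *)
Lemma bowtie_imp_closed (U V : set (upper_bowtie X)) :
  dual_carrier (upper_bowtie X) U -> dual_carrier (upper_bowtie X) V ->
  dual_carrier (upper_bowtie X) (rs_imp U V).
Proof.
have [comm _ _ invK contra] := bowtie_urquhart.
move=> AU AV.
have -> : rs_imp U V = rs_neg (rs_mul U (rs_neg V)).
  apply/seteqP; split=> x.
    move=> H [y [z [Uy nVz /contra]]]; rewrite invK => /comm R.
    exact: nVz (H _ _ R Uy).
  move=> nH y z R Uy; apply: contrapT => nVz; apply: nH.
  exists y, (rs_inv z); split=> //; first by rewrite /rs_neg /mkset invK.
  exact/contra/comm.
apply: bowtie_neg_closed; apply: bowtie_mul_closed => //.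
exact: bowtie_neg_closed.
Qed.

(** Compactness gives one [y] above |z| that serves all [U] and [V]. Then u <= y and v <= -y, so R y
    (-y) z weakens to [R u v z]. *)
Lemma bowtie_R_of_filtered u v z :
  (forall U V, A U -> A V -> U u -> V v ->
     down_closure ss_le (pos U `&` neg V) `|z|) -> bowtie_R u v z.
Proof.
move=> H; have [cX _ _] := ss_priestley XP.
pose S (p : set (bowtie X) * set (bowtie X)) :=
  [set y | ss_le `|z| y] `&` (pos p.1 `&` neg p.2).
have [y Hy] : exists y, forall P,
    [set S p | p in [set p | [/\ A p.1, A p.2, p.1 u & p.2 v]]] P -> P y.
  apply: compact_directed_cap => //.
  - exists (S (setT, setT)), (setT, setT) => //.
    by split=> //; exact: clopen_up_setT.
  - move=> _ [[U V] [/= AU AV Uu Vv] <-]; split; last first.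
      by have [y UVy zy] := H U V AU AV Uu Vv; exists y.
    apply: closedI; first exact: (priestley_closed_up (ss_priestley XP)).
    have [[cU _] [cV _]] := (AU, AV).
    by case: (bowtie_pos_neg_clopen cU cV).
  - move=> _ _ [[U V] [/= AU AV Uu Vv] <-] [[U' V'] [/= AU' AV' Uu' Vv'] <-].
    exists (S (U `&` U', V `&` V')); last by move=> t [/= ? [[? ?] [? ?]]].
    by exists (U `&` U', V `&` V') => //; split=> //; exact: clopen_up_setI.
have {}Hy U V : A U -> A V -> U u -> V v -> S (U, V) y.
  by move=> *; apply: Hy; exists (U, V).
have [rf _ _] := bowtie_le_order XP.
have AT := clopen_up_setT (@bowtie_le X).
have [zy _] := Hy setT setT AT AT Logic.I Logic.I.
apply: (bowtie_R_mono (bowtie_R_inl_neg zy)) (rf z).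
  apply: (priestley_le bowtie_priestley) => U AU Uu.
  by have [_ []] := Hy U setT AU AT Uu Logic.I.
apply: (priestley_le bowtie_priestley) => V AV Vv.
by have [_ []] := Hy setT V AT AV Logic.I Vv.
Qed.

(** Each of the three parts of [bowtie_mulE] omits [z] for some pair of neighbourhoods; intersecting
    the three pairs excludes all parts at once. *)
Lemma bowtie_R_sep u v z : ~ bowtie_R u v z -> exists U V : set (upper_bowtie X),
  [/\ dual_carrier (upper_bowtie X) U, dual_carrier (upper_bowtie X) V,
      U u, V v & ~ rs_mul U V z].
Proof.
move=> nR; apply: contrapT => nUV.
have mulz (U V : set (bowtie X)) : A U -> A V -> U u -> V v -> @rs_mul (upper_bowtie X) U V z.
  by move=> AU AV Uu Vv; apply: contrapT => nz; apply: nUV; exists U, V.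
have fail (P : set (bowtie X) -> set (bowtie X) -> Prop) :
    ((forall U V, A U -> A V -> U u -> V v -> P U V) -> bowtie_R u v z) ->
    exists U V, [/\ A U, A V, U u, V v & ~ P U V].
  move=> H; apply: contrapT => nP; apply/nR/H => U V AU AV Uu Vv.
  by apply: contrapT => nPUV; apply: nP; exists U, V.
have [U1 [V1 [AU1 AV1 U1u V1v n1]]] := fail _ (@bowtie_R_of_filtered u v z).
have [|U2 [V2 [AU2 AV2 U2u V2v n2]]] :=
    fail (fun U V => down_closure ss_le (pos V `&` neg U) `|z|).
  by move=> H; apply/bowtie_RC/bowtie_R_of_filtered => *; exact: H.
have [|U3 [V3 [AU3 AV3 U3u V3v n3]]] := fail (fun U V => (U `&` V) z).
  move=> H; have [rf _ _] := bowtie_le_order XP.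
  have AT := clopen_up_setT (@bowtie_le X).
  apply: (bowtie_R_mono (bowtie_R_diag z)) (rf z);
    apply: (priestley_le bowtie_priestley) => U AU Uu.
    by have [] := H U setT AU AT Uu Logic.I.
  by have [] := H setT U AT AU Logic.I Uu.
pose U := U1 `&` U2 `&` U3; pose V := V1 `&` V2 `&` V3.
have AU : A U by do 2 apply: clopen_up_setI => //.
have AV : A V by do 2 apply: clopen_up_setI => //.
have := mulz U V AU AV; rewrite bowtie_mulE; [|by case: AU|by case: AV].
case=> // [[[y [Uy Vy] zy]|[y [Vy Uy] zy]]|[Uz Vz]].
- by apply: n1; exists y => //; case: Uy Vy => [[? ?] ?] [[? ?] ?].
- by apply: n2; exists y => //; case: Uy Vy => [[? ?] ?] [[? ?] ?].
- by apply: n3; case: Uz Vz => [[? ?] ?] [[? ?] ?].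
Qed.

Lemma upper_bowtie_relevant : relevant_space (upper_bowtie X).
Proof.
split.
- exact: bowtie_priestley.
- exact: bowtie_mul_closed.
- exact: bowtie_imp_closed.
- exact: bowtie_R_mono.
- exact: bowtie_R_sep.
- exact: bowtie_neg_continuous.
- exact: bowtie_neg_antitone.
- by split; [exact: bowtie_base_clopen|exact: bowtie_base_up].
- move=> y z; split.
    move=> /(bowtie_leP XP)[[bz yz]|[ny zy]].
      exists z => //; apply/(bowtie_RP XP); constructor 3.
      rewrite /bowtie_dominates bowtie_abs_neg bowtie_neg_negative.
      by split=> //; exact: ss_lexx.
    exists (inl `|y|); first by exists `|y|.
    apply/(bowtie_RP XP); constructor 2.
    rewrite /bowtie_dominates bowtie_abs_neg; split=> //; exact: ss_lexx.
  move=> [x bx /(bowtie_RP XP)]; rewrite /bowtie_triangle /bowtie_dominates.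
  rewrite bowtie_abs_neg bowtie_neg_negative.
  case=> [[nx yx zx]|[ny xy zy]|[bz xz yz]]; apply/(bowtie_leP XP); [right|right|left] => //.
  (* Here [x] lies in both [X] and -X, so minimality gives |y| = |x| = |z|. *)
  have Dx := bowtie_base_negative bx nx.
  rewrite (ss_D_minimal XP Dx zx) -(ss_D_minimal XP Dx yx).
  split; last exact: ss_lexx.
  by apply: bowtie_D_negative; rewrite (ss_D_minimal XP Dx yx).
Qed.

Lemma upper_bowtie_sugihara : sugihara_relevant_space (upper_bowtie X).
Proof.
have Xrs := upper_bowtie_relevant.
by split=> //; apply/(urquhart_correspondence Xrs); exact: bowtie_urquhart.
Qed.

End bowtie_topology.

(** * Morphisms and natural isomorphisms *)

Section upper_bowtie_map.
Context (X Y : SS) (f : hom X Y).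
Local Notation g := (upper_bowtie_map f : bowtie (ss_str X) -> bowtie (ss_str Y)).
Local Notation "`| u |" := (bowtie_abs u).

Let XP := ss_strP X.
Let YP := ss_strP Y.
Let fP := ss_funP f.

Lemma upper_bowtie_map_abs (u : bowtie (ss_str X)) : `|g u| = ss_fun f `|u|.
Proof. by case: u => // x; rewrite /upper_bowtie_map bowtie_abs_neg. Qed.

Lemma upper_bowtie_map_neg (u : bowtie (ss_str X)) : g (bowtie_neg u) = bowtie_neg (g u).
Proof.
case: u => [x|x]; last by rewrite /upper_bowtie_map bowtie_negK.
have [Dx|nDx] := pselect (ss_D X x); last by rewrite (bowtie_neg_DC (mem_set nDx)).
by rewrite /upper_bowtie_map !bowtie_neg_D //; exact: (ssm_D fP).
Qed.

Lemma upper_bowtie_map_base (u : bowtie (ss_str X)) : bowtie_base (g u) = bowtie_base u.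
Proof.
apply/propext; case: u => [x|x]; first by split=> _; [exists x|exists (ss_fun f x)].
rewrite /upper_bowtie_map bowtie_base_neg; split=> [Dfx|[]//].
by case: (ssm_DC fP (set_typeP x : (~` ss_D X) _) Dfx).
Qed.

Lemma upper_bowtie_map_negative (u : bowtie (ss_str X)) :
  bowtie_negative (g u) = bowtie_negative u.
Proof. by rewrite -!bowtie_base_neg -upper_bowtie_map_neg upper_bowtie_map_base. Qed.

Lemma upper_bowtie_map_continuous : continuous g.
Proof.
have cneg (U : set (bowtie (ss_str Y))) : open U ->
    open [set y : Y | U (bowtie_neg (inl y))].
  move=> oU; have oN : open [set u : bowtie (ss_str Y) | U (bowtie_neg u)].
    by apply: open_comp oU => u _; exact: (bowtie_neg_continuous YP).
  by apply: open_comp oN => y _; exact: bowtie_inl_continuous.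
apply/continuousP => U oU; split.
  rewrite (_ : _ @^-1` _ = ss_fun f @^-1` [set y | U (inl y)])//.
  apply: open_comp => [x _|]; first exact: (ssm_continuous fP).
  by apply: open_comp oU => y _; exact: bowtie_inl_continuous.
rewrite (_ : _ @^-1` _ = \val @^-1` (ss_fun f @^-1` [set y | U (bowtie_neg (inl y))]))//.
apply: open_comp => [x _|]; first exact: set_val_continuous.
apply: open_comp => [x _|]; first exact: (ssm_continuous fP).
exact: cneg.
Qed.

(** If [a] dominates, the p-morphism condition lifts |a| to some [p] above |z|, and -p and [p] are
    the factors. If -z dominates on the image side, [z] serves as both factors. *)
Lemma upper_bowtie_map_back_mul (x y : bowtie (ss_str Y)) (z : bowtie (ss_str X)) :
  bowtie_R x y (g z) -> exists u v : bowtie (ss_str X),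
    [/\ bowtie_R u v z, bowtie_le x (g u) & bowtie_le y (g v)].
Proof.
have main a b : bowtie_dominates a b (g z) -> exists p : X,
    [/\ ss_le `|z| p, bowtie_le a (g (bowtie_neg (inl p))) & bowtie_le b (g (inl p))].
  move=> [na ba]; rewrite upper_bowtie_map_abs => /(ssm_back fP)[p zp fp].
  exists p; split=> //.
    rewrite upper_bowtie_map_neg /upper_bowtie_map fp -(bowtie_negativeP a).1//.
    by have [rf _ _] := bowtie_le_order YP; exact: rf.
  apply/(bowtie_leP YP); left; rewrite upper_bowtie_map_abs /= fp; split=> //.
  by exists (ss_fun f p); rewrite //= fp.
move=> /(bowtie_RP YP); rewrite /bowtie_triangle => -[h|h|h].
- have [|p [zp xp yp]] := main x y; first by move: h; rewrite /bowtie_dominates bowtie_abs_neg.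
  exists (bowtie_neg (inl p)), (inl p); split=> //.
  by apply: bowtie_RC; exact: bowtie_R_inl_neg.
- have [|p [zp xp yp]] := main y x; first by move: h; rewrite /bowtie_dominates bowtie_abs_neg.
  by exists (inl p), (bowtie_neg (inl p)); split=> //; exact: bowtie_R_inl_neg.
- move: h; rewrite /bowtie_dominates bowtie_neg_negative bowtie_abs_neg => -[bz xz yz].
  exists z, z; split; first exact: bowtie_R_diag.
    by apply/(bowtie_leP YP); left.
  by apply/(bowtie_leP YP); left.
Qed.

Lemma upper_bowtie_map_morphism : relevant_map (upper_bowtie_map f).
Proof.
have [commX _ _ invKX contraX] := bowtie_urquhart XP.
have [commY _ _ invKY contraY] := bowtie_urquhart YP.
have fle := ssm_isotone fP.
split.
- exact: upper_bowtie_map_continuous.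
- move=> x y /(bowtie_leP XP) xy; apply/(bowtie_leP YP).
  rewrite upper_bowtie_map_base upper_bowtie_map_negative !upper_bowtie_map_abs.
  by case: xy => -[? /fle ?]; [left|right].
- move=> x y z /(bowtie_RP XP) T; apply/(bowtie_RP YP).
  rewrite -upper_bowtie_map_neg /bowtie_triangle /bowtie_dominates.
  rewrite !upper_bowtie_map_negative !upper_bowtie_map_abs.
  by case: T => -[? /fle ? /fle ?]; [constructor 1|constructor 2|constructor 3].
- exact: upper_bowtie_map_back_mul.
(* Contraposition turns this back condition into the one for products. *)
- move=> x y z /commY/contraY; rewrite -[rs_inv (upper_bowtie_map f x)]upper_bowtie_map_neg.
  move=> /upper_bowtie_map_back_mul[u [w [/contraX R yu zw]]].
  exists u, (bowtie_neg w); split=> //; first by apply/commX; rewrite -[x]invKX.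
  rewrite [upper_bowtie_map f (bowtie_neg w)]upper_bowtie_map_neg -[z]invKY.
  exact: bowtie_neg_antitone.
- exact: upper_bowtie_map_neg.
- by apply/seteqP; split=> u; rewrite /preimage /mkset /= upper_bowtie_map_base.
Qed.

End upper_bowtie_map.

(* The order is definable from [R] and [I], so it need not be mentioned. *)
Lemma relevant_map_of_bijection (X Y : SRS) (f : X -> Y) (g : Y -> X) :
  continuous f -> cancel g f ->
  (forall x y z : X, rs_R x y z <-> rs_R (f x) (f y) (f z)) ->
  (forall x : X, f (rs_inv x) = rs_inv (f x)) ->
  (forall x : X, rs_I Y (f x) <-> rs_I X x) -> relevant_map f.
Proof.
move=> fc gK fR fv fI.
have [[Xrs _] [Yrs _]] := (srs_strP X, srs_strP Y).
have lexx := srs_lexx (srs_strP Y).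
split=> //.
- move=> x y /(rs_I_unit Xrs)[i Ii R]; apply/(rs_I_unit Yrs).
  by exists (f i); [apply/fI|apply/fR].
- by move=> x y z /fR.
- move=> x y z R; exists (g x), (g y); rewrite !gK; split=> //.
  by apply/fR; rewrite !gK.
- move=> x y z R; exists (g y), (g z); rewrite !gK; split=> //.
  by apply/fR; rewrite !gK.
- by apply/seteqP; split=> x /fI.
Qed.

Lemma SRS_iso_of_bijection (X Y : SRS) (f : hom X Y) (g : Y -> X) :
  continuous g -> cancel (srs_fun f) g -> cancel g (srs_fun f) ->
  (forall x y z : X, rs_R (srs_fun f x) (srs_fun f y) (srs_fun f z) -> rs_R x y z) ->
  is_iso f.
Proof.
move=> gc fK gK fR; have fP := srs_funP f.
have gP : relevant_map g.
  apply: (@relevant_map_of_bijection Y X g (srs_fun f)) => //.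
  - move=> x y z; split=> [R|/(rm_R fP)]; last by rewrite !gK.
    by apply: fR; rewrite !gK.
  - by move=> y; apply: (can_inj fK); rewrite (rm_inv fP) !gK.
  - by move=> y; rewrite -(rm_I fP) /preimage /mkset gK.
by exists (SRSHom gP); split; apply: SRS_hom_eq; apply/funext => x /=.
Qed.

Lemma SS_iso_of_bijection (X Y : SS) (f : hom X Y) (g : Y -> X) :
  continuous g -> cancel (ss_fun f) g -> cancel g (ss_fun f) ->
  (forall x y : X, ss_le (ss_fun f x) (ss_fun f y) -> ss_le x y) ->
  is_iso f.
Proof.
move=> gc fK gK fle; have fP := ss_funP f.
have gP : sugihara_space_map g.
  split=> //.
  - by move=> x y xy; apply: fle; rewrite !gK.
  - move=> y x gyx; exists (ss_fun f x) => //.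
    by rewrite -[y]gK; exact: (ssm_isotone fP).
  - by move=> y Dy; apply: contrapT => /(ssm_DC fP); rewrite gK.
  - by move=> y nDy /(ssm_D fP); rewrite gK.
by exists (SSHom gP); split; apply: SS_hom_eq; apply/funext => x /=.
Qed.

(** * Recovering a Sugihara relevant space from its set [I] *)

Section bowtie_counit.
Context (X : SRS).
Local Notation LX := (lower_bowtie (srs_str X)).

Let XP : sugihara_relevant_space X := srs_strP X.
Let LP : unpointed_sugihara_space LX := lower_bowtie_unpointed XP.

Definition bowtie_counit (u : upper_bowtie LX) : srs_str X :=
  match u with inl x => \val x | inr x => rs_inv (\val (\val x)) end.

Lemma bowtie_counit_neg (u : bowtie LX) :
  bowtie_counit (bowtie_neg u) = rs_inv (bowtie_counit u).
Proof.
case: u => [x|x] /=; last by rewrite srs_invK.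
have [Dx|nDx] := pselect (ss_D LX x); first by rewrite -/(bowtie_neg (inl x)) bowtie_neg_D.
by rewrite -/(bowtie_neg (inl x)) (bowtie_neg_DC (mem_set nDx)).
Qed.

Lemma bowtie_counit_I (u : bowtie LX) : rs_I X (bowtie_counit u) = bowtie_base u.
Proof.
apply/propext; case: u => [x|x].
  by split=> _; [exists x|exact: lower_bowtie_I].
split=> [Ix|[]//]; have : (~` ss_D LX) (\val x) := set_typeP x.
by case; apply: (srs_fixed XP) => //; exact: lower_bowtie_I.
Qed.

Lemma bowtie_counit_negative (u : bowtie LX) :
  rs_I X (rs_inv (bowtie_counit u)) = bowtie_negative u.
Proof. by rewrite -bowtie_counit_neg bowtie_counit_I bowtie_base_neg. Qed.

Lemma bowtie_counit_abs (u : bowtie LX) :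
  srs_abs (bowtie_counit u) = \val (bowtie_abs u).
Proof.
by case: u => x /=; rewrite ?(srs_abs_inv XP) (srs_absI (lower_bowtie_I _)).
Qed.

(** On both sides [R] is expressed by domination, which depends only on signs and absolute
    values. *)
Lemma bowtie_counit_R (u v w : bowtie LX) :
  bowtie_R u v w <-> rs_R (bowtie_counit u) (bowtie_counit v) (bowtie_counit w).
Proof.
have dom (a b c : bowtie LX) : bowtie_dominates a b c =
    srs_dominates (bowtie_counit a) (bowtie_counit b) (bowtie_counit c).
  by rewrite /srs_dominates bowtie_counit_negative !bowtie_counit_abs.
rewrite (bowtie_RP LP) (srs_RP XP) -bowtie_counit_neg /bowtie_triangle -!dom.
by rewrite /bowtie_dominates bowtie_abs_neg.
Qed.

Lemma bowtie_counit_continuous : continuous bowtie_counit.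
Proof.
have [Xrs _] := XP.
apply/continuousP => W oW; split.
  by apply/set_type_open; exists W.
apply/set_type_open; exists ((\val : LX -> X) @^-1` (rs_inv @^-1` W)) => //.
apply/(@set_type_open X); exists (rs_inv @^-1` W) => //.
by apply: open_comp => // x _; exact: (rs_inv_continuous Xrs).
Qed.

Definition bowtie_counit_inv (x : srs_str X) : upper_bowtie LX :=
  let a : LX := exist _ (srs_abs x) (mem_set (srs_I_abs XP x)) in
  if `[< rs_I X x >] then inl a else bowtie_neg (inl a).

Lemma bowtie_counit_invK : cancel bowtie_counit_inv bowtie_counit.
Proof.
move=> x; rewrite /bowtie_counit_inv; case: asboolP => [Ix|nIx].
  by rewrite /= srs_absI.
rewrite bowtie_counit_neg /= (srs_absN XP) ?(srs_invK XP)//.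
by case: (srs_I_total XP x).
Qed.

Lemma bowtie_counitK : cancel bowtie_counit bowtie_counit_inv.
Proof.
move=> u; rewrite /bowtie_counit_inv.
set a := exist _ _ _; have -> : a = bowtie_abs u.
  by apply: val_inj => /=; rewrite bowtie_counit_abs.
case: asboolP; rewrite bowtie_counit_I => h; first by rewrite -bowtie_base_abs.
by rewrite -(bowtie_negativeP u).1//; case: u {a} h => // x []; exists x.
Qed.

(** The map is glued from continuous pieces on the clopen set [I] and its complement, the second one
    through the involution. *)
Lemma bowtie_counit_inv_continuous : continuous bowtie_counit_inv.
Proof.
have [Xrs _] := XP; have [[oI clI] _] := rs_I_clopen_up Xrs.
apply/continuousP => U oU.
pose U1 : set LX := [set a | U (inl a)].
pose U2 : set LX := [set a | U (bowtie_neg (inl a))].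
have oU1 : open U1 by apply: open_comp oU => a _; exact: bowtie_inl_continuous.
have oU2 : open U2.
  have oN : open [set u : bowtie LX | U (bowtie_neg u)].
    by apply: open_comp oU => u _; exact: (bowtie_neg_continuous LP).
  by apply: open_comp oN => y _; exact: bowtie_inl_continuous.
rewrite (_ : _ @^-1` _ = (rs_I X `&` \val @` U1) `|`
    (~` rs_I X `&` rs_inv @^-1` (\val @` U2))).
  apply: openU; apply: openI => //.
  - exact: open_set_type_image.
  - exact: closed_openC.
  - apply: open_comp; first by move=> x _; exact: (rs_inv_continuous Xrs).
    exact: open_set_type_image.
apply/seteqP; split=> x; rewrite /preimage /mkset /bowtie_counit_inv;
  case: asboolP => [Ix|nIx].
- move=> Ux; left; split=> //; eexists; first exact: Ux.
  exact: srs_absI.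
- move=> Ux; right; split=> //; eexists; first exact: Ux.
  by apply: (srs_absN XP); case: (srs_I_total XP x).
- case=> [[_ [a Ua ax]]|[]//].
  by rewrite (_ : exist _ _ _ = a)//; apply: val_inj; rewrite /= srs_absI.
- case=> [[]//|[_ [a Ua ax]]].
  rewrite (_ : exist _ _ _ = a)//; apply: val_inj; rewrite /= (srs_absN XP)//.
  by case: (srs_I_total XP x).
Qed.

End bowtie_counit.

(** * Recovering an unpointed Sugihara space from X^bowtie *)

Section bowtie_unit.
Context (X : SS).
Let XP : unpointed_sugihara_space X := ss_strP X.
Local Notation UX := (upper_bowtie (ss_str X)).

(** The natural isomorphism is directed from the composite functor to the identity, so this is its
    component. *)
Definition bowtie_unit_inv (x : lower_bowtie UX) : ss_str X := bowtie_abs (\val x).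

Lemma bowtie_unit_inv_val (x : lower_bowtie UX) : \val x = inl (bowtie_unit_inv x).
Proof. by apply: bowtie_base_abs; exact: (lower_bowtie_I x). Qed.

Definition bowtie_unit (x : ss_str X) : lower_bowtie UX :=
  exist _ (inl x) (mem_set (ex_intro2 _ _ x Logic.I erefl : bowtie_base (inl x))).

Lemma bowtie_unitK : cancel bowtie_unit bowtie_unit_inv.
Proof. by []. Qed.

Lemma bowtie_unit_invK : cancel bowtie_unit_inv bowtie_unit.
Proof. by move=> x; apply: val_inj; rewrite /= -bowtie_unit_inv_val. Qed.

Lemma bowtie_unit_continuous : continuous bowtie_unit.
Proof.
apply/continuousP => _ [W oW <-].
by apply: open_comp oW => x _; exact: bowtie_inl_continuous.
Qed.

Lemma bowtie_unit_inv_le (x y : lower_bowtie UX) :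
  ss_le (bowtie_unit_inv x) (bowtie_unit_inv y) <-> ss_le x y.
Proof. by rewrite [X in _ <-> X]/ss_le /= !bowtie_unit_inv_val. Qed.

Lemma bowtie_unit_inv_D (x : lower_bowtie UX) :
  ss_D X (bowtie_unit_inv x) <-> ss_D (lower_bowtie UX) x.
Proof.
rewrite /= bowtie_unit_inv_val; split=> [Dx|E]; first by rewrite /rs_inv bowtie_neg_D.
have : bowtie_negative (bowtie_neg (inl (bowtie_unit_inv x))).
  by rewrite bowtie_neg_negative; exists (bowtie_unit_inv x).
by rewrite -[bowtie_neg _]E.
Qed.

Lemma bowtie_unit_inv_morphism : sugihara_space_map bowtie_unit_inv.
Proof.
split.
- apply/continuousP => W oW.
  rewrite (_ : _ @^-1` _ = \val @^-1` [set u : UX | W (bowtie_abs u)])//.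
  apply: open_comp => [x _|]; first exact: set_val_continuous.
  by apply: open_comp oW => u _; exact: bowtie_abs_continuous.
- by move=> x y /bowtie_unit_inv_le.
- move=> x z xz; exists (bowtie_unit z) => //.
  by apply/bowtie_unit_inv_le; rewrite bowtie_unitK.
- by move=> x /bowtie_unit_inv_D.
- by move=> x nDx /bowtie_unit_inv_D.
Qed.

End bowtie_unit.

(** * Functoriality and naturality *)

Definition lower_bowtie_obj (X : SRS) : SS := SSObj (lower_bowtie_unpointed (srs_strP X)).
Definition upper_bowtie_obj (X : SS) : SRS := SRSObj (upper_bowtie_sugihara (ss_strP X)).

Lemma bowtie_counit_morphism (X : SRS) : relevant_map (@bowtie_counit X).
Proof.
apply: (@relevant_map_of_bijection (upper_bowtie_obj (lower_bowtie_obj X)) X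
  _ (@bowtie_counit_inv X)).
- exact: bowtie_counit_continuous.
- exact: bowtie_counit_invK.
- exact: bowtie_counit_R.
- exact: bowtie_counit_neg.
- by move=> u; rewrite bowtie_counit_I.
Qed.

Theorem mainTheorem20 :
  exists (lower_obj : forall X : SRS, unpointed_sugihara_space (lower_bowtie (srs_str X)))
         (lower_hom : forall (X Y : SRS) (f : hom X Y),
            sugihara_space_map (lower_bowtie_map f))
         (upper_obj : forall X : SS, sugihara_relevant_space (upper_bowtie (ss_str X)))
         (upper_hom : forall (X Y : SS) (f : hom X Y),
            relevant_map (upper_bowtie_map f)),
    equivalence_of_categories
      (@Prefunctor SRS SS
         (fun X => SSObj (lower_obj X))
         (fun X Y f => @SSHom (SSObj (lower_obj X)) (SSObj (lower_obj Y))
                         (lower_bowtie_map f) (lower_hom X Y f)))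
      (@Prefunctor SS SRS
         (fun X => SRSObj (upper_obj X))
         (fun X Y f => @SRSHom (SRSObj (upper_obj X)) (SRSObj (upper_obj Y))
                         (upper_bowtie_map f) (upper_hom X Y f))).
Proof.
exists (fun X => lower_bowtie_unpointed (srs_strP X)), lower_bowtie_map_morphism.
exists (fun X => upper_bowtie_sugihara (ss_strP X)), upper_bowtie_map_morphism.
split.
- split=> [X|X Y Z g f]; apply: SS_hom_eq; apply/funext => x; exact: val_inj.
- split=> [X|X Y Z g f]; apply: SRS_hom_eq; apply/funext => -[x|x] //.
    by rewrite /= valK.
  by rewrite [RHS](upper_bowtie_map_neg g (inl _)).
- exists (fun X => @SRSHom (upper_bowtie_obj (lower_bowtie_obj X)) X _
    (@bowtie_counit_morphism X)); split=> [X|X Y f].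
    apply: (@SRS_iso_of_bijection (upper_bowtie_obj (lower_bowtie_obj X)) X
      _ (@bowtie_counit_inv X)).
    + exact: bowtie_counit_inv_continuous.
    + exact: bowtie_counitK.
    + exact: bowtie_counit_invK.
    + by move=> x y z /bowtie_counit_R.
  apply: SRS_hom_eq; apply/funext => -[x|x] //.
  (* On the formal copy, naturality says that [f] commutes with the involution. *)
  rewrite [LHS](bowtie_counit_neg (inl _)).
  exact: (esym (rm_inv (srs_funP f) _)).
- exists (fun X => @SSHom (lower_bowtie_obj (upper_bowtie_obj X)) X _
    (@bowtie_unit_inv_morphism X)); split=> [X|X Y f].
    apply: (@SS_iso_of_bijection (lower_bowtie_obj (upper_bowtie_obj X)) X
      _ (@bowtie_unit X)).
    + exact: bowtie_unit_continuous.
    + exact: bowtie_unit_invK.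
    + exact: bowtie_unitK.
    + by move=> x y /bowtie_unit_inv_le.
  by apply: SS_hom_eq; apply/funext => x; exact: (upper_bowtie_map_abs f).
Qed.
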